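(* For every outer-string graph $G$, $\mathrm{tw}(G)\le 15\,\mathrm{had}(G)-2$.
   Context: An outer-string graph is the intersection graph of a finite set of curves in a closed disk, each curve having an endpoint on the boundary of the disk (vertices are the curves, two adjacent iff they intersect). $\mathrm{tw}(G)$ is the treewidth of $G$ and $\mathrm{had}(G)$ (the Hadwiger number) is the largest $t$ such that $K_t$ is a minor of $G$. *)

(* Defs.v *)
From mathcomp Require Import all_boot all_order all_algebra.
From mathcomp Require Import boolp.

Set Implicit Arguments.
Unset Strict Implicit.
Unset Printing Implicit Defensive.

(* MathComp-Analysis is loaded only after the graph-theoretic part because its
   set notations shadow those of finset. *)

Record sgraph := SGraph {
  vertex :> finType;
  edge : rel vertex;
  edge_sym : symmetric edge;
  edge_irrefl : irreflexive edge }.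

Section Complete.
Variable t : nat.
Definition complete_rel : rel 'I_t := [rel x y | x != y].
Lemma complete_sym : symmetric complete_rel.
Proof. by move=> x y; rewrite /complete_rel /= eq_sym. Qed.
Lemma complete_irrefl : irreflexive complete_rel.
Proof. by move=> x; rewrite /complete_rel /= eqxx. Qed.
Definition complete_graph := SGraph complete_sym complete_irrefl.
End Complete.

Definition induced_rel (G : sgraph) (A : {set G}) : rel G :=
  [rel x y | [&& x \in A, y \in A & edge x y]].

(* The subgraph induced by [A] is connected; connected graphs are nonempty. *)
Definition connected_in (G : sgraph) (A : {set G}) : Prop :=
  A != set0 /\
  forall x y, x \in A -> y \in A -> connect (induced_rel A) x y.

(* [ucycle] also accepts sequences of length 0 and 2 (an edge traversed back
   and forth), which are not cycles of a simple graph. *)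
Definition acyclic (G : sgraph) : Prop :=
  forall s : seq G, ucycle (@edge G) s -> (size s <= 2)%N.

Definition is_tree (F : sgraph) : Prop := connected_in [set: F] /\ acyclic F.

(* The last clause includes that every vertex of G lies in some bag. *)
Definition tree_decomposition (G F : sgraph) (bag : F -> {set G}) : Prop :=
  [/\ is_tree F,
      forall u v : G, edge u v -> exists x, u \in bag x /\ v \in bag x
    & forall v : G, connected_in [set x | v \in bag x]].

(* The predecessor truncates only if all bags are empty, that is, only for the
   graph without vertices. *)
Definition decomposition_width (G F : sgraph) (bag : F -> {set G}) : nat :=
  (\max_x #|bag x|).-1.

Definition has_decomposition_of_width (G : sgraph) (w : nat) : Prop :=
  exists (F : sgraph) (bag : F -> {set G}),
    tree_decomposition bag /\ decomposition_width bag = w.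

Lemma ex_decomposition (G : sgraph) :
  exists w, `[< has_decomposition_of_width G w >].
Proof.
pose bag (x : complete_graph 1) := [set: G].
have conn (A : {set complete_graph 1}) : A != set0 -> connected_in A.
  by move=> A0; split=> // x y _ _; rewrite (ord1 x) (ord1 y) connect0.
exists (decomposition_width bag); apply/asboolP; exists (complete_graph 1), bag.
split=> //; split.
- split; first by apply: conn; apply/set0Pn; exists ord0; rewrite inE.
  move=> s /andP[_ /card_uniqP <-]; apply: leq_trans (max_card _) _.
  by rewrite card_ord.
- by move=> u v _; exists ord0; rewrite !inE.
- by move=> v; apply: conn; apply/set0Pn; exists ord0; rewrite !inE.
Qed.

Definition treewidth (G : sgraph) : nat := ex_minn (ex_decomposition G).

Definition minor (H G : sgraph) : Prop :=
  exists branch : H -> {set G},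
    [/\ forall x, connected_in (branch x),
        forall x y, x != y -> [disjoint branch x & branch y]
      & forall x y, edge x y ->
          exists u v, [/\ u \in branch x, v \in branch y & edge u v]].

Lemma ex_complete_minor (G : sgraph) :
  exists t, `[< minor (complete_graph t) G >].
Proof.
exists 0%N; apply/asboolP; exists (fun=> set0).
by split; case.
Qed.

Lemma complete_minor_le (G : sgraph) (t : nat) :
  `[< minor (complete_graph t) G >] -> (t <= #|G|)%N.
Proof.
move=> /asboolP[br [conn disj _]].
have ne x : exists v, v \in br x by apply/set0Pn; case: (conn x).
pose f x := xchoose (ne x).
have fP x : f x \in br x := xchooseP (ne x).
have f_inj : injective f.
  move=> x y fxy; apply/eqP; apply: contraT => /disj/disjointFr/(_ (fP x)).
  by rewrite fxy fP.
by rewrite -[t]card_ord; apply: leq_card f_inj.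
Qed.

Definition hadwiger (G : sgraph) : nat :=
  ex_maxn (ex_complete_minor G) (@complete_minor_le G).

From mathcomp Require Import all_classical all_reals all_analysis.
Import Order.TTheory GRing.Theory Num.Theory.
Import numFieldNormedType.Exports.
Local Open Scope ring_scope.
Local Open Scope classical_set_scope.

Section OuterString.
Variable R : realType.

Definition sqdist (p q : R * R) : R := (p.1 - q.1) ^+ 2 + (p.2 - q.2) ^+ 2.

Definition closed_disk (a : R * R) (r : R) : set (R * R) :=
  [set p | sqdist p a <= r ^+ 2].

Definition boundary_circle (a : R * R) (r : R) : set (R * R) :=
  [set p | sqdist p a = r ^+ 2].

(* A curve is parametrized by [0, 1]; values outside [0, 1] are irrelevant. *)
Definition curve (c : R -> R * R) : Prop := {within `[0, 1], continuous c}.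

Definition trace (c : R -> R * R) : set (R * R) := c @` `[0, 1].

Definition outer_curve (a : R * R) (r : R) (c : R -> R * R) : Prop :=
  [/\ curve c, trace c `<=` closed_disk a r
    & boundary_circle a r (c 0) \/ boundary_circle a r (c 1)].

Definition is_intersection_graph (G : sgraph) (S : G -> set (R * R)) : Prop :=
  forall u v : G, u != v -> (edge u v <-> S u `&` S v !=set0).

Definition outer_string (G : sgraph) : Prop :=
  exists (a : R * R) (r : R) (c : G -> R -> R * R),
    [/\ 0 < r, forall v, outer_curve a r (c v)
      & is_intersection_graph (fun v => trace (c v))].

End OuterString.

(* Main.v *)
(** Order the curves of an outer-string graph cyclically by their endpoints on
    the circle. Two connected vertex sets whose roots interleave must intersect
    or be adjacent, since the corresponding unions of curves cross in the disk.
    Hence pairwise disjoint connected sets that all meet three given disjoint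
    intervals of the cyclic order ("tripods") pairwise touch.

    Write h for the Hadwiger number, and cut the cyclic order into intervals
    A, C, B, D. If 3h disjoint connected sets joined A to B and 3h joined C to
    D, then tripods and pairs made of an A-B set and a C-D set would give a
    K_(h+1) minor; so by Menger's theorem fewer than 3h vertices separate A from
    B or C from D. Choosing the cuts so that each interval contains 3h elements
    of a given set S of size 12h, this separation splits S in a balanced way, and
    the usual recursion yields a tree-decomposition with bags S :|: X of size at
    most 12h + (3h - 1).

    The crossing property is proved by discretization: two disjoint compact sets
    are at positive distance, so the unions of curves can be replaced by chains
    p_0, ..., p_m and q_0, ..., q_n of small step. The vectors p_i - q_j then
    form a grid of nonzero vectors in which every cell lies in an open
    half-plane, so the boundary of the grid crosses any given ray an even number
    of times, whereas interleaving endpoints force an odd number for the ray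
    spanned by p_m - p_0. *)

Require Import Defs.
From mathcomp Require Import all_boot all_order all_algebra.
From mathcomp Require Import boolp ring lra zify.

Set Implicit Arguments.
Unset Strict Implicit.
Unset Printing Implicit Defensive.

(** * Menger's theorem *)

Lemma injection_into_set (T : finType) (I : {set T}) k :
  k <= #|I| -> exists f : 'I_k -> T, injective f /\ forall i, f i \in I.
Proof.
move=> kI; exists (fun i => enum_val (widen_ord kI i)); split=> [i j|i].
  by move/enum_val_inj/(congr1 val) => /= ij; apply: val_inj.
exact: enum_valP.
Qed.

Section Connectedness.
Variables (V : finType) (e : rel V).
Hypothesis e_sym : symmetric e.
Implicit Types A B W Z : {set V}.

Definition restrict W : rel V := [rel x y | [&& x \in W, y \in W & e x y]].

Definition conn W :=
  W != set0 /\ forall x y, x \in W -> y \in W -> connect (restrict W) x y.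

(** A common vertex counts as touching: two crossing unions of curves may share a curve instead of
    containing two adjacent ones. *)
Definition touch W Z :=
  exists x y, [/\ x \in W, y \in Z & (x == y) || e x y].

Definition meets W Z := exists2 x, x \in W & x \in Z.

Lemma restrict_sym W : symmetric (restrict W).
Proof. by move=> x y; rewrite /restrict /= e_sym andbCA. Qed.

Lemma touchC W Z : touch W Z -> touch Z W.
Proof.
by case=> x [y [xW yZ xy]]; exists y, x; rewrite yZ xW eq_sym e_sym.
Qed.

Lemma touchS W W' Z Z' :
  W \subset W' -> Z \subset Z' -> touch W Z -> touch W' Z'.
Proof.
move=> /subsetP WW' /subsetP ZZ' [x [y [/WW' ? /ZZ' ? ?]]].
by exists x, y.
Qed.

Lemma meets_touch W Z : meets W Z -> touch W Z.
Proof. by case=> x xW xZ; exists x, x; rewrite eqxx. Qed.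

Lemma connect_restrictS W W' x y :
  W \subset W' -> connect (restrict W) x y -> connect (restrict W') x y.
Proof.
move=> /subsetP WW'; apply: connect_sub => a b /and3P[aW bW ab].
by apply: connect1; rewrite /restrict /= !WW'.
Qed.

Lemma conn1 x : conn [set x].
Proof.
split=> [|a b]; first by apply/set0Pn; exists x; rewrite inE.
by rewrite !inE => /eqP-> /eqP->.
Qed.

Lemma connU W Z : conn W -> conn Z -> touch W Z -> conn (W :|: Z).
Proof.
move=> [W0 cW] [Z0 cZ] [w [z [wW zZ wz]]]; split.
  by apply/set0Pn; exists w; rewrite inE wW.
have wz' : connect (restrict (W :|: Z)) w z.
  case/orP: wz => [/eqP->//|wz]; apply: connect1.
  by rewrite /restrict /= !inE wW zZ orbT wz.
have to_w x : x \in W :|: Z -> connect (restrict (W :|: Z)) x w.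
  case/setUP=> [xW|xZ].
    exact: connect_restrictS (subsetUl _ _) (cW _ _ xW wW).
  apply: (connect_trans (connect_restrictS (subsetUr _ _) (cZ _ _ xZ zZ))).
  by rewrite (sym_connect_sym (@restrict_sym _)).
move=> x y /to_w xw /to_w yw; apply: connect_trans xw _.
by rewrite (sym_connect_sym (@restrict_sym _)).
Qed.

Lemma conn2 x y : e x y -> conn [set x; y].
Proof.
move=> xy; apply: connU (conn1 x) (conn1 y) _.
by exists x, y; rewrite !inE !eqxx xy orbT.
Qed.

Lemma conn_crossing W A :
  conn W -> meets W A -> ~ W \subset A ->
  exists x y, [/\ x \in W :&: A, y \in W :\: A & e x y].
Proof.
move=> [_ cW] [a aW aA] /negP/subsetPn[b bW bA]; apply: contrapT => nxy.
case/connectP: (cW a b aW bW) bA => p; elim: p a aA {aW} => /= [a aA _ ->|].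
  by rewrite aA.
move=> c p IH a aA /andP[/and3P[aW cW' ac] pp] lp; apply: (IH c) => //.
apply/negPn/negP => cA; apply: nxy; exists a, c.
by rewrite !inE aW aA cW' cA.
Qed.

End Connectedness.

Lemma conn_sub (V : finType) (e e' : rel V) W :
  subrel e e' -> conn e W -> conn e' W.
Proof.
move=> ee' [W0 cW]; split=> // x y xW yW.
apply: connect_sub (cW x y xW yW) => a b /and3P[aW bW /ee' ab].
by apply: connect1; rewrite /restrict /= aW bW.
Qed.

Section Menger.
Variable V : finType.
Implicit Types (e : rel V) (A B : {set V}).

Definition separation e V1 V2 :=
  V1 :|: V2 = [set: V] /\
  forall u v, u \in V1 :\: V2 -> v \in V2 :\: V1 -> ~~ e u v.

(** Connected sets stand in for paths: they glue by plain unions and serve directly as branch sets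
    of minors. *)
Definition linkage e A B k (W : 'I_k -> {set V}) :=
  [/\ forall i, conn e (W i),
      forall i j, i != j -> [disjoint W i & W j]
    & forall i, meets (W i) A /\ meets (W i) B].

Lemma separationC e V1 V2 :
  symmetric e -> separation e V1 V2 -> separation e V2 V1.
Proof.
move=> se [V12 sep]; split=> [|u v uV vV]; first by rewrite setUC.
by rewrite se sep.
Qed.

Lemma linkage_sub e e' A B k (W : 'I_k -> {set V}) :
  subrel e e' -> linkage e A B W -> linkage e' A B W.
Proof. by move=> ee' [cW dW mW]; split=> // i; apply: conn_sub (cW i). Qed.

(** Here [k] disjoint sets all meet the [k]-element set [A], so each contains exactly one vertex of
    [A] and can be indexed by it. Two linkages that end in a common separator can then be matched
    vertex by vertex. *)
Lemma linkage_index e A B k (W : 'I_k -> {set V}) :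
  linkage e A B W -> #|A| = k ->
  exists W' : V -> {set V},
    [/\ {in A, forall a, [/\ conn e (W' a), meets (W' a) B & a \in W' a]},
        {in A &, forall a b, b \in W' a -> a = b}
      & {in A &, forall a b, a != b -> [disjoint W' a & W' b]}].
Proof.
move=> [cW dW mW] Ak.
have /choice[g gP] i : exists a, a \in W i /\ a \in A.
  by case: (mW i) => -[a]; exists a.
have W_eq i j a : a \in W i -> a \in W j -> i = j.
  move=> ai aj; apply/eqP/negPn/negP => /dW/disjoint_setI0/setP/(_ a).
  by rewrite !inE ai aj.
have g_inj : injective g.
  move=> i j gij; apply: (W_eq _ _ (g i)); first by case: (gP i).
  by rewrite gij; case: (gP j).
have imA : g @: 'I_k = A.
  apply/eqP; rewrite eqEcard; apply/andP; split.
    by apply/subsetP => _ /imsetP[i _ ->]; case: (gP i).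
  by rewrite card_imset // card_ord Ak.
have gA a : a \in A -> exists i, g i = a.
  by rewrite -imA => /imsetP[i _ ->]; exists i.
have /choice[W' W'P] a : exists Wa, a \in A -> exists2 i, g i = a & Wa = W i.
  have [/gA[i gi]|_] := boolP (a \in A); last by exists set0.
  by exists (W i) => _; exists i.
exists W'; split=> [a /W'P[i gi ->]|a b /W'P[i gi ->] /W'P[j gj _] bi|a b].
- by split=> //; [case: (mW i) | rewrite -gi; case: (gP i)].
- rewrite -gi -gj; congr g; apply: (W_eq _ _ b) => //.
  by rewrite -gj; case: (gP j).
- move=> /W'P[i gi ->] /W'P[j gj ->] ab; apply: dW.
  by apply: contraNneq ab => ij; rewrite -gi -gj ij.
Qed.

Lemma conn_restrict_sub e A W :
  conn (restrict e A) W -> meets W A -> W \subset A.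
Proof.
move=> cW mWA; apply/negPn/negP => nWA.
case: (conn_crossing cW mWA); first exact/negP.
by move=> x [y [_ /setDP[_ yA] /and3P[_]]]; rewrite (negPf yA).
Qed.

(** The restricted graph keeps the vertex set [V], so its separations need not respect [V1]; cutting
    one side down to [V1] and adding [V2] to the other repairs this. Edges of [e] from [V1 :\: V2]
    to [V2 :\: V1] do no harm, because they start at [x], which lies in [U2]. *)
Lemma separation_restrict e V1 V2 U1 U2 x :
  symmetric e ->
  (forall u v, u \in V1 :\: V2 -> v \in V2 :\: V1 -> e u v -> u = x) ->
  V1 :|: V2 = [set: V] ->
  separation (restrict e V1) U1 U2 -> x |: (V1 :&: V2) \subset U2 ->
  separation e (U1 :&: V1) (U2 :|: V2) /\
  (U1 :&: V1) :&: (U2 :|: V2) \subset U1 :&: U2.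
Proof.
move=> se xV V12 [U12 sepU] /subsetP XU2.
have cV v : (v \in V1) || (v \in V2) by rewrite -in_setU V12.
have cU v : (v \in U1) || (v \in U2) by rewrite -in_setU U12.
split; first split.
- apply/setP => v; have := cU v; have := cV v; rewrite !inE.
  by case: (v \in V1); case: (v \in U1); case: (v \in U2); case: (v \in V2).
- move=> u v; rewrite !inE => /andP[/norP[uU2 uV2] /andP[uU1 uV1]].
  case/andP=> nv _; apply/negP => uv.
  have [vV1|vV1] := boolP (v \in V1).
    have vU1 : v \notin U1 by apply: contraNN nv => ->.
    have := sepU u v; rewrite /restrict /= !inE uU1 uU2 vU1 uV1 vV1 uv /=.
    by have := cU v; rewrite (negPf vU1) /= => -> /(_ isT isT).
  have := cV v; rewrite (negPf vV1) /= => vV2.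
  have := XU2 x; rewrite !inE eqxx => /(_ isT).
  by rewrite -(xV u v) ?(negPf uU2) // !inE ?uV2 ?uV1 ?vV1 ?vV2.
- apply/subsetP => v; rewrite !inE => /andP[/andP[-> vV1] /orP[->//|vV2]].
  by apply: XU2; rewrite !inE vV1 vV2 orbT.
Qed.

Lemma linkage_glue k e A B V1 V2 x y (W Z : 'I_k -> {set V}) :
  symmetric e -> e x y -> x \in V1 :\: V2 -> y \in V2 :\: V1 ->
  #|V1 :&: V2|.+1 = k ->
  A \subset V1 -> B \subset V2 ->
  linkage (restrict e V1) (x |: (V1 :&: V2)) A W ->
  linkage (restrict e V2) (y |: (V1 :&: V2)) B Z ->
  exists T : 'I_k -> {set V}, linkage e A B T.
Proof.
move=> se exy /setDP[xV1 xV2] /setDP[yV2 yV1] cardS AV1 BV2 lW lZ.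
set S := V1 :&: V2 in cardS lW lZ.
have SP v : v \in S = (v \in V1) && (v \in V2) by rewrite inE.
have xS : x \notin S by rewrite SP (negPf xV2) andbF.
have yS : y \notin S by rewrite SP (negPf yV1).
have yx : y != x by apply: contraNneq yV1 => ->.
have cardP : #|x |: S| = k by rewrite cardsU1 xS.
have cardQ : #|y |: S| = k by rewrite cardsU1 yS.
have [W' [W1 W2 W3]] := linkage_index lW cardP.
have [Z' [Z1 Z2 Z3]] := linkage_index lZ cardQ.
have WV1 p : p \in x |: S -> W' p \subset V1.
  case/W1=> cW [a aW /(subsetP AV1) aV1] _.
  by apply: conn_restrict_sub cW _; exists a.
have ZV2 q : q \in y |: S -> Z' q \subset V2.
  case/Z1=> cZ [b bZ /(subsetP BV2) bV2] _.
  by apply: conn_restrict_sub cZ _; exists b.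
(* Sets of the two linkages lie in [V1] and [V2] respectively, so they meet only in [S], where each
   is indexed by the meeting vertex itself. *)
have WZ p q v : p \in x |: S -> q \in y |: S -> v \in W' p -> v \in Z' q ->
    [/\ v \in S, p = v & q = v].
  move=> pP qQ vW vZ; have vS : v \in S.
    by rewrite SP (subsetP (WV1 p pP)) // (subsetP (ZV2 q qQ)).
  by split=> //; [apply: W2 | apply: Z2]; rewrite // inE vS orbT.
(* The set through [x] continues along the edge [xy] into the set through [y]; the others continue
   through their common vertex of [S]. *)
pose swap p := if p == x then y else p.
have swapQ p : p \in x |: S -> swap p \in y |: S.
  by rewrite /swap !inE; case: ifP => _ //=; rewrite ?eqxx // => ->; rewrite orbT.
have swapS p : swap p \in S -> swap p = p.
  by rewrite /swap; case: ifP => // _; rewrite (negPf yS).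
have swap_inj : {in x |: S &, injective swap}.
  have yP : y \notin x |: S by rewrite !in_setU1 negb_or yx.
  move=> p q pP qP; rewrite /swap.
  case: eqP => [->|_]; case: eqP => [->|_] // E; first by rewrite E qP in yP.
  by rewrite -E pP in yP.
have [p [p_inj pP]] := injection_into_set (eq_leq (esym cardP)).
exists (fun i => W' (p i) :|: Z' (swap (p i))); split=> [i|i j ij|i].
- have [cW _ pW] := W1 _ (pP i); have [cZ _ pZ] := Z1 _ (swapQ _ (pP i)).
  have sub C : subrel (restrict e C) e by move=> a b /and3P[].
  apply: (connU se (conn_sub (@sub _) cW) (conn_sub (@sub _) cZ)).
  exists (p i), (swap (p i)); split=> //.
  by rewrite /swap; case: (eqVneq (p i) x) => [->|_]; rewrite ?exy ?eqxx ?orbT.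
- rewrite -setI_eq0; apply/eqP/setP => v; rewrite !inE; apply/negP.
  have pij : p i != p j by rewrite (inj_eq p_inj).
  have sij : swap (p i) != swap (p j).
    by apply: contra_neq pij => /swap_inj; apply.
  have := W3 _ _ (pP i) (pP j) pij.
  have := Z3 _ _ (swapQ _ (pP i)) (swapQ _ (pP j)) sij.
  move=> /disjoint_setI0/setP/(_ v) + /disjoint_setI0/setP/(_ v).
  rewrite !inE => Zij Wij /andP[/orP[vi|vi] /orP[vj|vj]].
  + by rewrite vi vj in Wij.
  + have [vS pi sj] := WZ _ _ _ (pP i) (swapQ _ (pP j)) vi vj.
    by move: pij; rewrite -(swapS (p j)) ?sj ?pi ?eqxx.
  + have [vS pj si] := WZ _ _ _ (pP j) (swapQ _ (pP i)) vj vi.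
    by move: pij; rewrite -(swapS (p i)) ?si ?pj ?eqxx.
  + by rewrite vi vj in Zij.
- have [_ [a aW aA] _] := W1 _ (pP i); have [_ [b bZ bB] _] := Z1 _ (swapQ _ (pP i)).
  by split; [exists a | exists b]; rewrite // inE ?aW ?bZ ?orbT.
Qed.

(* Göring's argument: delete an edge xy; if this creates a separation (V1, V2)
   of order k - 1, with x on the side of A, link A to (V1 :&: V2) + x inside V1
   and (V1 :&: V2) + y to B inside V2. *)
Theorem menger k e A B :
  symmetric e ->
  (forall V1 V2, separation e V1 V2 -> A \subset V1 -> B \subset V2 ->
     k <= #|V1 :&: V2|) ->
  exists W : 'I_k -> {set V}, linkage e A B W.
Proof.
have [n] := ubnP #|[set p : V * V | e p.1 p.2]|.
elim: n e A B => // n IH e A B en se ksep.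
have [[x [y [xy exy]]]|none] := pselect (exists x y, x != y /\ e x y); last first.
  (* Without edges between distinct vertices, [(A, B :|: ~: A)] is a separation with intersection
     [A :&: B], and singletons form the linkage. *)
  have kAB : k <= #|A :&: B|.
    rewrite (_ : A :&: B = A :&: (B :|: ~: A)); last first.
      by apply/setP => v; rewrite !inE; case: (v \in A); rewrite ?orbF.
    apply: ksep; rewrite ?subsetUl //; split=> [|u v].
      by apply/setP => v; rewrite !inE; case: (v \in A); rewrite ?orbT.
    rewrite !inE => /andP[_ uA] /andP[vA _]; apply/negP => uv.
    by apply: none; exists u, v; split=> //; apply: contraNneq vA => <-.
  have [f [f_inj fAB]] := injection_into_set kAB.
  exists (fun i => [set f i]); split=> [i|i j ij|i]; first exact: conn1.
    by rewrite disjoints1 inE (inj_eq f_inj).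
  have := fAB i; rewrite inE => /andP[fA fB].
  by split; exists (f i); rewrite ?inE.
pose e' : rel V := [rel u v | e u v && ((u, v) \notin [:: (x, y); (y, x)])].
have e'e : subrel e' e by move=> u v /andP[].
have se' : symmetric e'.
  move=> u v; rewrite /e' /= se !inE !xpair_eqE.
  by rewrite orbC [(v == y) && _]andbC [(v == x) && _]andbC.
have smaller (W : {set V}) z t : z \notin W -> e z t ->
    #|[set p : V * V | restrict e W p.1 p.2]| < n.
  move=> zW zt; rewrite -ltnS; apply: leq_trans en; rewrite ltnS.
  apply: proper_card; apply/properP; split.
    by apply/subsetP => p; rewrite !inE => /and3P[].
  by exists (z, t); rewrite !inE // /restrict /= (negPf zW).
have [ksep'|] := pselect (forall V1 V2, separation e' V1 V2 ->
    A \subset V1 -> B \subset V2 -> k <= #|V1 :&: V2|).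
  have [] := IH e' A B _ se' ksep'.
    rewrite -ltnS; apply: leq_trans en; rewrite ltnS.
    apply: proper_card; apply/properP; split.
      by apply/subsetP => p; rewrite !inE => /andP[].
    by exists (x, y); rewrite !inE //= negb_and !inE eqxx orbT.
  by move=> W lW; exists W; apply: linkage_sub lW.
move=> /existsNP[V1 /existsNP[V2]].
move=> /not_implyP[sep /not_implyP[AV1 /not_implyP[BV2 /negP]]].
rewrite -ltnNge => ltk.
(* Restoring the deleted edge must destroy the separation; [u] and [v] are [x] and [y], named by the
   side on which they lie. *)
have [u [v [uV vV uv]]] : exists u v,
    [/\ u \in V1 :\: V2, v \in V2 :\: V1 & e u v].
  apply: contrapT => nuv; suff /ksep/(_ AV1 BV2) : separation e V1 V2.
    by rewrite leqNgt ltk.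
  case: sep => V12 _; split=> // u v uV vV; apply/negP => uv.
  by apply: nuv; exists u, v.
have V12 := sep.1.
have crossing_xy u' v' : u' \in V1 :\: V2 -> v' \in V2 :\: V1 -> e u' v' ->
    (u', v') = (x, y) \/ (u', v') = (y, x).
  move=> u'V v'V u'v'; have := sep.2 _ _ u'V v'V.
  by rewrite /e' /= u'v' negbK => /predU1P[->|/predU1P[->|//]]; [left|right].
have uniq_uv u' v' : u' \in V1 :\: V2 ->
    v' \in V2 :\: V1 -> e u' v' -> (u', v') = (u, v).
  have disj w : w \in V1 :\: V2 -> w \in V2 :\: V1 -> False.
    by rewrite !inE => /andP[_ ->].
  move=> u'V v'V /(crossing_xy _ _ u'V v'V) xy'.
  have [[ux vy]|[uy vx]] := crossing_xy _ _ uV vV uv; case: xy' => -[u'x v'y].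
  - by rewrite ux vy u'x v'y.
  - by case: (disj u); rewrite // ux -v'y.
  - by case: (disj u); rewrite // uy -v'y.
  - by rewrite uy vx u'x v'y.
have /setDP[uV1 uV2] := uV; have /setDP[vV2 vV1] := vV.
(* Adding [u] to [V2] gives a separation of [e] itself, so [(V1, V2)] has order exactly [k - 1]. *)
have cardS : #|V1 :&: V2|.+1 = k.
  apply/eqP; rewrite eqn_leq ltk /=.
  have -> : #|V1 :&: V2|.+1 = #|V1 :&: (u |: V2)|.
    rewrite setIUr [V1 :&: [set u]](setIidPr _) ?sub1set //.
    by rewrite cardsU1 !inE (negPf uV2) andbF.
  apply: ksep => //; last by rewrite subsetU // BV2 orbT.
  split=> [|u' v'].
    by rewrite setUCA V12 setUT.
  rewrite !inE negb_or -andbA => /and3P[u'u u'V2 u'V1] /andP[v'V1].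
  case/orP=> [/eqP v'u|v'V2]; first by rewrite v'u uV1 in v'V1.
  apply/negP => /(uniq_uv u' v').
  by rewrite !inE u'V2 u'V1 v'V1 v'V2 => /(_ isT isT)[/eqP]; rewrite (negPf u'u).
have [W lW] : exists W : 'I_k -> {set V},
    linkage (restrict e V1) (u |: (V1 :&: V2)) A W.
  apply: IH; [|exact: restrict_sym|].
    by apply: (smaller V1 v u) => //; rewrite se.
  move=> U2 U1 sepU XU2 AU1.
  have [] := separation_restrict se _ V12 (separationC (restrict_sym se _) sepU) XU2.
    by move=> u' v' u'V v'V /(uniq_uv _ _ u'V v'V)[].
  move=> /ksep le_k /subset_leq_card; rewrite [U2 :&: U1]setIC; apply: leq_trans.
  by apply: le_k; rewrite ?subsetI ?AU1 // subsetU ?BV2 ?orbT.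
have [Z lZ] : exists Z : 'I_k -> {set V},
    linkage (restrict e V2) (v |: (V1 :&: V2)) B Z.
  apply: IH; [|exact: restrict_sym|].
    exact: (smaller V2 u v).
  move=> U2 U1 sepU XU2 BU1; rewrite [V1 :&: V2]setIC in XU2.
  have V21 : V2 :|: V1 = [set: V] by rewrite setUC.
  have [] := separation_restrict se _ V21 (separationC (restrict_sym se _) sepU) XU2.
    by move=> v' u' v'V u'V; rewrite se => /(uniq_uv _ _ u'V v'V)[].
  move=> /(separationC se)/ksep le_k /subset_leq_card.
  rewrite [U2 :&: U1]setIC; apply: leq_trans; rewrite setIC.
  by apply: le_k; rewrite ?subsetI ?BU1 // subsetU ?AV1 ?orbT.
exact: linkage_glue se uv uV vV cardS AV1 BV2 lW lZ.
Qed.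

End Menger.

(** * Linkages between opposite intervals of a cyclic order *)

Lemma hadwiger_max (G : sgraph) t : minor (complete_graph t) G -> t <= hadwiger G.
Proof.
by rewrite /hadwiger; case: ex_maxnP => h _ hmax tG; apply/hmax/asboolP.
Qed.

Lemma complete_minorP (G : sgraph) (J : finType) (F : J -> {set G}) (I : {set J}) :
  (forall i, i \in I -> conn (@edge G) (F i)) ->
  {in I &, forall i j, i != j ->
     [disjoint F i & F j] /\ touch (@edge G) (F i) (F j)} ->
  #|I| <= hadwiger G.
Proof.
move=> cF dtF; apply: hadwiger_max.
have [f [f_inj fI]] := injection_into_set (leqnn #|I|).
exists (F \o f); split=> [x|x y xy|x y xy] /=; first exact: cF.
  by have [] := dtF _ _ (fI x) (fI y); rewrite ?(inj_eq f_inj).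
have [|d [u [v [uF vF uv]]]] := dtF _ _ (fI x) (fI y); first by rewrite inj_eq.
exists u, v; split=> //; case/orP: uv => // /eqP uv.
by rewrite uv in uF; rewrite (disjointFr d uF) in vF.
Qed.

Lemma disjoint_setUl (T : finType) (X Y Z : {set T}) :
  [disjoint X :|: Y & Z] = [disjoint X & Z] && [disjoint Y & Z].
Proof. by rewrite -!setI_eq0 setIUl setU_eq0. Qed.

Lemma disjoint_setUr (T : finType) (X Y Z : {set T}) :
  [disjoint X & Y :|: Z] = [disjoint X & Y] && [disjoint X & Z].
Proof. by rewrite -!setI_eq0 setIUr setU_eq0. Qed.

Section CrossingLinkages.
Variables (G : sgraph) (h : nat) (A B C D : {set G}).
Local Notation e := (@edge G).
Local Notation sym := (@edge_sym G).

Hypothesis h_pos : 0 < h.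
Hypothesis h_had : hadwiger G <= h.
Hypothesis cover : forall v, [|| v \in A, v \in B, v \in C | v \in D].
Hypothesis disjCD : [disjoint A :|: B & C :|: D].
Hypothesis disj_CD : [disjoint C & D].

Definition crossing_touch := forall P Q, conn e P -> conn e Q ->
  meets P A -> meets P B -> meets Q C -> meets Q D -> touch e P Q.

Definition tripods_touch X Y Z := forall P Q, conn e P -> conn e Q ->
  [disjoint P & Q] ->
  meets P X -> meets P Y -> meets P Z ->
  meets Q X -> meets Q Y -> meets Q Z -> touch e P Q.

Lemma tripods_few X Y Z (J : finType) (P : J -> {set G}) (I : {set J}) :
  tripods_touch X Y Z ->
  (forall i, conn e (P i)) ->
  (forall i j, i != j -> [disjoint P i & P j]) ->
  (forall i, i \in I -> [/\ meets (P i) X, meets (P i) Y & meets (P i) Z]) ->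
  #|I| <= h.
Proof.
move=> tri cP dP mP; apply: leq_trans h_had; apply: (complete_minorP (F := P)) => // i j.
move=> /mP[iX iY iZ] /mP[jX jY jZ] ij; have dij := dP _ _ ij.
by split=> //; apply: tri.
Qed.

Definition meeting (J : finType) (P : J -> {set G}) (Z : {set G}) : {set J} :=
  [set i | P i :&: Z != set0].

Lemma meetingP (J : finType) (P : J -> {set G}) Z i :
  reflect (meets (P i) Z) (i \in meeting P Z).
Proof.
rewrite inE; apply: (iffP (set0Pn _)) => [[x /setIP[]]|[x xP xZ]]; first by exists x.
by exists x; rewrite inE xP.
Qed.

Section Pure.
Variable P : 'I_(3 * h) -> {set G}.
Hypothesis linkP : linkage e A B P.
Hypothesis triC : tripods_touch A B C.
Hypothesis triD : tripods_touch A B D.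

Let pure := ~: (meeting P C :|: meeting P D).

Lemma meeting_le X : tripods_touch A B X -> #|meeting P X| <= h.
Proof.
have [cP dP mP] := linkP; move=> triX.
by apply: (tripods_few triX cP dP) => i /meetingP iX; have [] := mP i.
Qed.

(** Of the [3 * h] sets, at most [h] are tripods meeting [C] and at most [h] are tripods meeting
    [D]. *)
Lemma pure_ge : h <= #|pure|.
Proof.
clear h_pos disj_CD disjCD.
have := cardsC (meeting P C :|: meeting P D); rewrite card_ord.
have := (leq_card_setU (meeting P C) (meeting P D)).1.
have := meeting_le triC; have := meeting_le triD; rewrite -/pure.
lia.
Qed.

(** At least [2 * h] sets meet [C] or [D], and at most [h] of them meet [D]. *)
Lemma tripods_ge : #|pure| <= h -> h <= #|meeting P C :\: meeting P D|.
Proof.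
clear h_pos disj_CD disjCD.
have := cardsC (meeting P C :|: meeting P D); rewrite card_ord -/pure.
have := cardsU (meeting P C) (meeting P D); have := cardsD (meeting P C) (meeting P D).
have := subset_leq_card (subsetIl (meeting P C) (meeting P D)).
have := meeting_le triC; have := meeting_le triD.
lia.
Qed.

Lemma pure_sub i : i \in pure -> P i \subset A :|: B.
Proof.
rewrite !inE negb_or !negbK => /andP[/eqP C0 /eqP D0]; apply/subsetP => v vP.
have := cover v; rewrite inE => /or4P[->//|->|vC|vD]; rewrite ?orbT //.
  by have := in_set0 v; rewrite -C0 inE vP vC.
by have := in_set0 v; rewrite -D0 inE vP vD.
Qed.

End Pure.

(** The edge by which [P] leaves [C] ends in [D]. It can replace [P], and as it has a single vertex
    in [C], at most one of several disjoint sets avoiding [D] can meet it. *)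
Lemma pure_edge (P : {set G}) : conn e P -> meets P C -> meets P D ->
  P \subset C :|: D ->
  exists c d, [/\ c \in P :&: C, d \in P :&: D & e c d].
Proof.
move=> cP mC [d dP dD] /subsetP sP; have [|c [d' [cP' dP' cd]]] := conn_crossing cP mC.
  by move/subsetP/(_ d dP) => dC; rewrite (disjointFr disj_CD dC) in dD.
exists c, d'; split=> //; move: dP'; rewrite !inE => /andP[nC dP']; rewrite dP'.
by have := sP _ dP'; rewrite inE (negPf nC).
Qed.


(* The "pure" indices are those of sets contained in A :|: B (resp. C :|: D).
   If at most [h] of the [P i] are pure, at least [h] of them are tripods
   avoiding D. Either some tripod misses [h] pure edges [c j, d j], and joins the
   [h] unions of a pure [P] with such an edge, or each tripod can be merged with
   its own edge, and these unions are joined by one more pure [P]. *)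
Lemma few_pure (P Q : 'I_(3 * h) -> {set G}) :
  linkage e A B P -> linkage e C D Q -> crossing_touch ->
  tripods_touch A B C -> tripods_touch A B D ->
  let pureP := ~: (meeting P C :|: meeting P D) in
  let pureQ := ~: (meeting Q A :|: meeting Q B) in
  h <= #|pureQ| -> (forall j, j \in pureQ -> Q j \subset C :|: D) -> h < #|pureP|.
Proof.
move=> lP lQ crossing triC triD pureP pureQ leQ subQ.
rewrite ltnNge; apply/negP => pureP_le.
have [cP dP mP] := lP; have [cQ dQ mQ] := lQ.
have [p [p_inj pP]] := injection_into_set (pure_ge lP triC triD).
have [q [q_inj qP]] := injection_into_set leQ.
have [t [t_inj tP]] := injection_into_set (tripods_ge lP triC triD pureP_le).
have /choice[c /choice[d cdP]] j : exists c d,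
    [/\ c \in Q (q j) :&: C, d \in Q (q j) :&: D & e c d].
  by have [mC mD] := mQ (q j); apply: pure_edge; rewrite ?subQ.
pose E j := [set c j; d j].
have EQ j : E j \subset Q (q j).
  by have [/setIP[cj _] /setIP[dj _] _] := cdP j; rewrite subUset !sub1set cj.
have ECD j : E j \subset C :|: D.
  have [/setIP[_ cj] /setIP[_ dj] _] := cdP j.
  by rewrite subUset !sub1set !inE cj dj orbT.
have cE j : conn e (E j) by apply: conn2; [exact: sym | case: (cdP j)].
have mEC j : meets (E j) C.
  by exists (c j); [rewrite !inE eqxx | case: (cdP j) => /setIP[]].
have mED j : meets (E j) D.
  by exists (d j); [rewrite !inE eqxx orbT | case: (cdP j) => _ /setIP[]].
have tPE i j : touch e (P i) (E j).
  by have [? ?] := mP i; apply: crossing.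
have dEE i j : i != j -> [disjoint E i & E j].
  move=> ij; apply: (disjointWl (EQ i)); apply: (disjointWr (EQ j)).
  by apply: dQ; rewrite (inj_eq q_inj).
have dPE i j : [disjoint P (p i) & E j].
  apply: (disjointWl (pure_sub (pP i))); exact: disjointWr (ECD j) disjCD.
have dtp i j : t i != p j.
  apply: contraTneq (tP i) => ->; have := pP j; rewrite !inE.
  by case/norP=> /negPf->; rewrite andbF.
have tTT i j : i != j -> touch e (P (t i)) (P (t j)).
  move=> ij; have [[? ?] [? ?]] := (mP (t i), mP (t j)).
  have [/setDP[/meetingP ? _] /setDP[/meetingP ? _]] := (tP i, tP j).
  by apply: triC => //; apply: dP; rewrite (inj_eq t_inj).
have dPP i j : p i != p j -> [disjoint P (p i) & P (p j)] by exact: dP.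
(* One distinguished set and [h] unions make [h + 1] branch sets, one more than the Hadwiger number
   allows. *)
pose J := option 'I_h.
suff: exists F : J -> {set G}, (forall x, conn e (F x)) /\
    forall x y, x != y -> [disjoint F x & F y] /\ touch e (F x) (F y).
  case=> F [cF dtF]; have := complete_minorP (F := F) (I := [set: J]) (fun x _ => cF x)
    (fun x y _ _ => dtF x y).
  by rewrite cardsT card_option card_ord => /leq_trans/(_ h_had); rewrite ltnn.
suff: exists F0 (F : 'I_h -> {set G}), conn e F0 /\
    [/\ forall i, conn e (F i),
        forall i, [disjoint F0 & F i] /\ touch e F0 (F i)
      & forall i j, i != j -> [disjoint F i & F j] /\ touch e (F i) (F j)].
  case=> F0 [F [cF0 [cF dF0 dF]]].
  exists (fun x => if x is Some i then F i else F0).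
  split=> [[]//|[i|] [j|] //= ij].
  - exact: dF.
  - have [d0 t0] := dF0 i; rewrite disjoint_sym; split=> //.
    by apply: touchC t0; exact: sym.
have symG := sym.
have [[i Ti]|meetE] := pselect (exists i, forall j, ~ meets (P (t i)) (E j)).
  exists (P (t i)), (fun j => P (p j) :|: E j); split=> //; split=> [j|j|j k jk].
  - exact: connU.
  - split; last first.
      apply: touchS (tPE (t i) j); [exact: subxx | exact: subsetUr].
    rewrite disjoint_setUr dP ?dtp //= -setI_eq0.
    apply/negPn/negP => /set0Pn[x /setIP[xP xE]].
    by case: (Ti j); exists x.
  - split; last first.
      by apply: touchS (tPE (p j) k); [exact: subsetUl | exact: subsetUr].
    rewrite disjoint_setUl (disjoint_setUr (P (p j))) (disjoint_setUr (E j)).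
    rewrite dP ?(inj_eq p_inj) // dPE dEE //=.
    by rewrite disjoint_sym dPE.
have /choice[s sP] i : exists j, meets (P (t i)) (E j).
  apply: contrapT => nj; apply: meetE; exists i => j mj.
  by apply: nj; exists j.
have TE i j : meets (P (t i)) (E j) -> c j \in P (t i).
  case=> x xP; rewrite !inE => /orP[/eqP<-//|/eqP xd].
  have := tP i; rewrite !inE negbK => /andP[/eqP/setP/(_ x)].
  by rewrite !inE xP xd; have [_ /setIP[_ ->]] := cdP j.
have TE_inj i i' : meets (P (t i)) (E (s i')) -> i = i'.
  move=> /TE ci; have ci' := TE _ _ (sP i'); apply/eqP/negPn/negP => ii'.
  have /disjointFr/(_ ci) : [disjoint P (t i) & P (t i')].
    by apply: dP; rewrite (inj_eq t_inj).
  by rewrite ci'.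
have s_inj i i' : i != i' -> s i != s i'.
  by apply: contra_neq => ss; apply: TE_inj; rewrite -ss.
have dTE i i' : i != i' -> [disjoint P (t i) & E (s i')].
  move=> ii'; rewrite -setI_eq0; apply: contra_neqT ii' => /set0Pn[x /setIP[xP xE]].
  by apply: TE_inj; exists x.
exists (P (p (Ordinal h_pos))), (fun i => P (t i) :|: E (s i)).
split=> //; split=> [i|i|i j ij].
- by apply: connU => //; apply: meets_touch.
- split; last first.
    by apply: touchS (tPE _ (s i)); [exact: subxx | exact: subsetUr].
  by rewrite disjoint_setUr dPE dP // eq_sym.
- split; last by apply: touchS (tTT _ _ ij); exact: subsetUl.
  rewrite disjoint_setUl (disjoint_setUr (P (t i))) (disjoint_setUr (E (s i))).
  rewrite dP ?(inj_eq t_inj) // dTE // dEE ?s_inj //=.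
  by rewrite andbT disjoint_sym dTE // eq_sym.
Qed.

End CrossingLinkages.

(** By [few_pure], applied in both directions, each linkage has [h + 1] pure members. Pure members
    of different linkages are disjoint, so uniting them in pairs yields [h + 1] disjoint connected
    sets, which touch by crossing. *)
Lemma crossing_linkages (G : sgraph) (h : nat) (A B C D : {set G})
    (P Q : 'I_(3 * h) -> {set G}) :
  0 < h -> hadwiger G <= h ->
  (forall v, [|| v \in A, v \in B, v \in C | v \in D]) ->
  [disjoint A :|: B & C :|: D] -> [disjoint A & B] -> [disjoint C & D] ->
  linkage (@edge G) A B P -> linkage (@edge G) C D Q ->
  crossing_touch A B C D ->
  tripods_touch A B C -> tripods_touch A B D ->
  tripods_touch C D A -> tripods_touch C D B -> False.
Proof.
move=> h_pos h_had cover dABCD dAB dCD lP lQ crossing tC tD tA tB.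
have coverC v : [|| v \in C, v \in D, v \in A | v \in B].
  by have := cover v; case: (v \in A); case: (v \in B); rewrite ?orbT //= orbF.
have crossingC : crossing_touch C D A B.
  move=> X Y cX cY XC XD YA YB.
  by apply: touchC (crossing _ _ cY cX YA YB XC XD); apply: edge_sym.
have subP := pure_sub cover (P := P); have subQ := pure_sub coverC (P := Q).
have geQ := pure_ge h_had lQ tA tB; have geP := pure_ge h_had lP tC tD.
have gtP := few_pure h_pos h_had cover dABCD dCD lP lQ crossing tC tD geQ subQ.
have dCDAB : [disjoint C :|: D & A :|: B] by rewrite disjoint_sym.
have gtQ := few_pure h_pos h_had coverC dCDAB dAB lQ lP crossingC tA tB geP subP.
have [p [p_inj pP]] := injection_into_set gtP.
have [q [q_inj qQ]] := injection_into_set gtQ.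
have [cP dP mP] := lP; have [cQ dQ mQ] := lQ.
have dPQ i j : [disjoint P (p i) & Q (q j)].
  by apply: (disjointWl (subP _ (pP i))); apply: disjointWr (subQ _ (qQ j)) _.
have tPQ i j : touch (@edge G) (P i) (Q j).
  by have [[? ?] [? ?]] := (mP i, mQ j); apply: crossing.
have : #|[set: 'I_h.+1]| <= hadwiger G; last first.
  by rewrite cardsT card_ord => /leq_trans/(_ h_had); rewrite ltnn.
apply: (complete_minorP (F := fun i => P (p i) :|: Q (q i))) => [i _|i j _ _ ij].
- by apply: connU => //; apply: edge_sym.
- split; last first.
    by apply: touchS (tPQ (p i) (q j)); [exact: subsetUl | exact: subsetUr].
  rewrite disjoint_setUl (disjoint_setUr (P (p i))) (disjoint_setUr (Q (q i))).
  rewrite dP ?(inj_eq p_inj) // dPQ dQ ?(inj_eq q_inj) // andbT.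
  by rewrite disjoint_sym dPQ.
Qed.

(** * Balanced separations from a cyclic vertex order *)

Section CrossingOrder.
Variables (G : sgraph) (idx : G -> nat).
Hypothesis idx_inj : injective idx.
Local Notation e := (@edge G).

(** The cyclic order is cut open into a linear one, in which [a], [c], [b], [d] still alternate
    between [P] and [Q]. *)
Definition crossing_order := forall (P Q : {set G}) a b c d,
  conn e P -> conn e Q -> a \in P -> b \in P -> c \in Q -> d \in Q ->
  idx a < idx c -> idx c < idx b -> idx b < idx d -> touch e P Q.

Hypothesis crossing : crossing_order.
Variable h : nat.
Hypothesis h_pos : 0 < h.
Hypothesis h_had : hadwiger G <= h.

Definition precedes (X Y : {set G}) :=
  forall x y, x \in X -> y \in Y -> idx x < idx y.

(** By disjointness the elements [x] of [P] and [x'] of [Q] in [X] differ. If [x] comes first, then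
    [x], [x'], [y], [z'] interleave; otherwise [x'], [x], [y'], [z] do. *)
Lemma tripods_touch_ordered (X Y Z : {set G}) :
  precedes X Y -> precedes Y Z -> tripods_touch X Y Z.
Proof.
move=> XY YZ P Q cP cQ dPQ [x xP xX] [y yP yY] [z zP zZ].
move=> [x' xQ xX'] [y' yQ yY'] [z' zQ zZ'].
have /eqP : idx x != idx x'.
  by apply: contraTneq xP => /idx_inj->; rewrite (disjointFl dPQ).
case: (ltngtP (idx x) (idx x')) => // lt _.
  by apply: (@crossing _ _ x y x' z') => //; [apply: XY | apply: YZ].
apply: touchC; first exact: edge_sym.
by apply: (@crossing _ _ x' y' x z) => //; [apply: XY | apply: YZ].
Qed.

Definition slice m n : {set G} := [set v | m <= idx v < n].

Lemma slice_precedes m n m' n' : n <= m' -> precedes (slice m n) (slice m' n').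
Proof. by move=> nm x y; rewrite !inE; lia. Qed.

Lemma slice_disjoint m n m' n' : n <= m' -> [disjoint slice m n & slice m' n'].
Proof.
move=> nm; rewrite -setI_eq0; apply/eqP/setP => v; rewrite !inE; lia.
Qed.

Lemma opposite_slices_separation n1 n2 n3 n4 :
  n1 <= n2 -> n2 <= n3 -> (forall v, idx v < n4) ->
  exists V1 V2, [/\ separation e V1 V2, #|V1 :&: V2| < 3 * h &
    (slice 0 n1 \subset V1 /\ slice n2 n3 \subset V2) \/
    (slice n1 n2 \subset V1 /\ slice n3 n4 \subset V2)].
Proof.
move=> n12 n23 lt4; apply: contrapT => nsep.
have link (X Y : {set G}) :
    (forall V1 V2, separation e V1 V2 -> X \subset V1 -> Y \subset V2 ->
       3 * h <= #|V1 :&: V2|) -> exists W : 'I_(3 * h) -> {set G}, linkage e X Y W.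
  exact: menger (@edge_sym G).
have [|P lP] := link (slice 0 n1) (slice n2 n3).
  move=> V1 V2 sepV XV YV; rewrite leqNgt; apply/negP => lt.
  by apply: nsep; exists V1, V2; split=> //; left.
have [|Q lQ] := link (slice n1 n2) (slice n3 n4).
  move=> V1 V2 sepV XV YV; rewrite leqNgt; apply/negP => lt.
  by apply: nsep; exists V1, V2; split=> //; right.
(* The slices play the roles of [A], [C], [B], [D] in this order, so that [A] is opposite to [B] and
   [C] to [D]. *)
have [AC CB BD] : [/\ precedes (slice 0 n1) (slice n1 n2),
    precedes (slice n1 n2) (slice n2 n3) & precedes (slice n2 n3) (slice n3 n4)].
  by split; apply: slice_precedes.
have AB : precedes (slice 0 n1) (slice n2 n3) by apply: slice_precedes.
have CD : precedes (slice n1 n2) (slice n3 n4) by apply: slice_precedes.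
have triACB := tripods_touch_ordered AC CB.
have triABD := tripods_touch_ordered AB BD.
have triACD := tripods_touch_ordered AC CD.
have triCBD := tripods_touch_ordered CB BD.
apply: (crossing_linkages h_pos h_had _ _ _ _ lP lQ) => //.
- by move=> v; have := lt4 v; rewrite !inE; lia.
- rewrite disjoint_setUl (disjoint_setUr (slice 0 n1)) (disjoint_setUr (slice n2 n3)).
  rewrite [[disjoint slice n2 n3 & slice n1 n2]]disjoint_sym.
  by rewrite !slice_disjoint //; lia.
- exact: slice_disjoint.
- exact: slice_disjoint.
- move=> X Y cX cY [a aX aA] [b bX bB] [c cY' cC] [d dY dD].
  by apply: (@crossing _ _ a b c d); [..|apply: AC|apply: CB|apply: BD].
- by move=> X Y cX cY dXY XA XB XC YA YB YC; apply: triACB.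
- by move=> X Y cX cY dXY XC XD XA YC YD YA; apply: triACD.
- by move=> X Y cX cY dXY XC XD XB YC YD YB; apply: triCBD.
Qed.

(** A discrete intermediate value argument: as [idx] is injective, lengthening the prefix by one
    adds at most one element of [S]. *)
Lemma prefix_of_size (S : {set G}) m : m <= #|S| ->
  exists n, #|S :&: slice 0 n| = m.
Proof.
have step n : #|S :&: slice 0 n.+1| <= #|S :&: slice 0 n|.+1.
  have [v idx_v|none] := pickP (fun v => idx v == n).
    apply: (@leq_trans #|v |: (S :&: slice 0 n)|); last first.
      by rewrite cardsU1; case: (v \notin _); rewrite ?leqnSn.
    apply/subset_leq_card/subsetP => w.
    rewrite !inE !leq0n /= ltnS (leq_eqVlt (idx w)).
    case/andP=> -> /orP[/eqP w_n|->]; last by rewrite orbT.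
    by rewrite (_ : w = v) ?eqxx //; apply: idx_inj; rewrite w_n (eqP idx_v).
  apply: leqW; apply/subset_leq_card/subsetP => w.
  rewrite !inE !leq0n /= ltnS (leq_eqVlt (idx w)).
  by rewrite none.
have slice00 : slice 0 0 = set0 by apply/setP => v; rewrite !inE ltn0.
elim: m => [|m IH] mS.
  by exists 0; rewrite slice00 setI0 cards0.
have [n Sn] := IH (ltnW mS).
pose p := fun i => m < #|S :&: slice 0 i|.
have exp : exists i, p i.
  exists (\max_v idx v).+1; rewrite /p (setIidPl _) //.
  by apply/subsetP => v _; rewrite inE ltnS leq_bigmax.
case: (ex_minnP exp) => -[|i] pi mini.
  by move: pi; rewrite /p slice00 setI0 cards0.
exists i.+1; apply/eqP; rewrite eqn_leq (leq_trans (step i)) //.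
by rewrite ltnS leqNgt; apply/negP => /mini; rewrite ltnn.
Qed.

Lemma slice_card (S : {set G}) m n : m <= n ->
  #|S :&: slice m n| = #|S :&: slice 0 n| - #|S :&: slice 0 m|.
Proof.
move=> mn; have -> : S :&: slice m n = (S :&: slice 0 n) :\: (S :&: slice 0 m).
  by apply/setP => v; rewrite !inE /=; case: (v \in S) => //=; lia.
have sub : S :&: slice 0 m \subset S :&: slice 0 n.
  by apply/subsetP => v; rewrite !inE => /andP[-> /=]; lia.
by rewrite cardsD (setIidPr sub).
Qed.

(** The cuts divide [S] into four quarters of size [3 * h]; whichever opposite pair of slices is
    separated, each side receives a whole quarter. *)
Lemma balanced_separation (S : {set G}) : #|S| = 4 * (3 * h) ->
  exists V1 V2, [/\ separation e V1 V2, #|V1 :&: V2| < 3 * h,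
    3 * h <= #|S :&: V1| & 3 * h <= #|S :&: V2|].
Proof.
move=> S4; have [n1 Sn1] : exists n, #|S :&: slice 0 n| = 3 * h.
  by apply: prefix_of_size; lia.
have [n2 Sn2] : exists n, #|S :&: slice 0 n| = 2 * (3 * h).
  by apply: prefix_of_size; lia.
have [n3 Sn3] : exists n, #|S :&: slice 0 n| = 3 * (3 * h).
  by apply: prefix_of_size; lia.
have mono m n : #|S :&: slice 0 m| < #|S :&: slice 0 n| -> m <= n.
  rewrite ltnNge; apply: contraNT; rewrite -ltnNge => nm.
  by apply/subset_leq_card/setIS/subsetP => v; rewrite !inE; lia.
have n12 : n1 <= n2 by apply: mono; lia.
have n23 : n2 <= n3 by apply: mono; lia.
(* The last cut lies beyond all indices; the maximum with [n3] is needed because [n3] itself may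
   exceed them. *)
pose n4 := maxn n3 (\max_v idx v).+1.
have lt4 v : idx v < n4 by rewrite leq_max ltnS leq_bigmax orbT.
have Sn4 : #|S :&: slice 0 n4| = 4 * (3 * h).
  by rewrite (setIidPl _) //; apply/subsetP => v _; rewrite inE lt4.
have n34 : n3 <= n4 by rewrite leq_maxl.
have [V1 [V2 [sepV ltV sub]]] := opposite_slices_separation n12 n23 lt4.
have le m n (V : {set G}) : slice m n \subset V -> #|S :&: slice m n| <= #|S :&: V|.
  by move=> sV; apply/subset_leq_card/setIS.
have [[c12 c23] c34] := (slice_card S n12, slice_card S n23, slice_card S n34).
by exists V1, V2; case: sub => -[/le le1 /le le2]; split=> //; lia.
Qed.

End CrossingOrder.

(** * Tree-decompositions from balanced separations *)

Section BagSequences.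
Variable G : sgraph.
Implicit Types (s : seq {set G}) (U S Y Z : {set G}).

Lemma subset_bigcup_seq s Y : Y \in s -> Y \subset \bigcup_(X <- s) X.
Proof. by rewrite bigcup_seq => Ys; apply: (bigcup_sup Y). Qed.

(* The bags of a tree-decomposition, listed in an order in which each new bag
   [Y] is a leaf attached to an earlier bag [Z]. *)
Inductive tree_like : seq {set G} -> Prop :=
| tree_like1 Y : tree_like [:: Y]
| tree_like_leaf s Y Z : tree_like s -> Z \in s ->
    (\bigcup_(X <- s) X) :&: Y \subset Z -> tree_like (rcons s Y).

Lemma tree_like_parent s : tree_like s ->
  exists2 par : nat -> nat, 0 < size s & forall j, 0 < j < size s -> par j < j /\
    forall i, i < j -> nth set0 s i :&: nth set0 s j \subset nth set0 s (par j).
Proof.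
elim=> {s} [Y|s Y Z _ [par s0 parP] Zs sub].
  by exists id => // -[|j].
(* The new bag has position [size s], and its parent is the first position of [Z]. *)
exists (fun j => if j == size s then index Z s else par j); rewrite size_rcons // => j.
case/andP=> j0; rewrite ltnS leq_eqVlt.
have [-> _|_ /= js] := eqVneq j (size s); last first.
  have [|lt parj] := parP j; first by rewrite j0.
  split=> // i ij; rewrite !nth_rcons js (ltn_trans lt js) (ltn_trans ij js).
  exact: parj.
split=> [|i ij]; first by rewrite index_mem.
rewrite !nth_rcons ij ltnn eqxx index_mem Zs nth_index //.
apply: subset_trans sub; apply: setSI.
by apply/subset_bigcup_seq/mem_nth.
Qed.

Section Tree.
Variables (n : nat) (par : nat -> nat).
Hypothesis par_lt : forall j, 0 < j < n.+1 -> par j < j.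

Definition parent_rel : rel 'I_n.+1 :=
  [rel i j : 'I_n.+1 | ((0 < i) && (par i == j)) || ((0 < j) && (par j == i))].

Lemma parent_sym : symmetric parent_rel.
Proof. by move=> i j; rewrite /parent_rel /= orbC. Qed.

Lemma parent_irrefl : irreflexive parent_rel.
Proof.
move=> i; rewrite /parent_rel /= orbb; apply/negP => /andP[i0 /eqP pi].
by have := par_lt (j := i); rewrite i0 ltn_ord pi ltnn => /(_ isT).
Qed.

Definition parent_graph := SGraph parent_sym parent_irrefl.

Lemma parent_of_larger (i j : 'I_n.+1) : parent_rel i j -> j < i -> par i = j.
Proof.
case/orP=> /andP[p0 /eqP pE] // ji; have := par_lt (j := j).
by rewrite p0 ltn_ord pE => /(_ isT); lia.
Qed.

(** Parents decrease the index and stay in [K], so following them from any node of [K] ends at [r].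
    This applies both to the whole tree and to the nodes whose bags contain a given vertex. *)
Lemma parent_connected (K : {set parent_graph}) r : r \in K ->
  (forall j, j \in K -> j != r -> 0 < (j : 'I_n.+1) /\
     exists2 p : 'I_n.+1, p \in K & val p = par (val (j : 'I_n.+1))) ->
  connected_in K.
Proof.
move=> rK up; split; first by apply/set0Pn; exists r.
have symK := sym_connect_sym (restrict_sym (@edge_sym parent_graph) K).
have to_r j : j \in K -> connect (induced_rel K) j r.
  have [m] := ubnP (val (j : 'I_n.+1)); elim: m j => // m IH j jm jK.
  have [->|jr] := eqVneq j r; first exact: connect0.
  have [j0 [p pK pj]] := up j jK jr; have ltp := par_lt (j := j).
  rewrite j0 ltn_ord -pj in ltp; have {}ltp := ltp isT.
  apply: (connect_trans (y := p)); last by apply: IH; rewrite // (leq_trans ltp).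
  by apply: connect1; rewrite /induced_rel /= jK pK /parent_rel /= j0 -pj eqxx.
move=> x y /to_r xr /to_r yr; apply: connect_trans xr _.
by move: yr; rewrite /induced_rel; have := symK y r; rewrite /restrict => ->.
Qed.

(* Both neighbours of the largest node of a cycle are its parent. *)
Lemma parent_acyclic : acyclic parent_graph.
Proof.
move=> s /andP[cyc us]; rewrite leqNgt; apply/negP => s3.
have x0 : 'I_n.+1 by exact: ord0.
have [m ms mmax] : exists2 m : 'I_n.+1, m \in s & forall j : 'I_n.+1, j \in s -> j <= m.
  case: s s3 {cyc us} => // x s _.
  have xs : x \in x :: s by rewrite inE eqxx.
  by case: (arg_maxnP (fun j : 'I_n.+1 => val j) xs) => m; exists m.
have [i q def_s] := rot_to ms.
have sub j : j \in q -> j \in s by rewrite -(mem_rot i s) def_s inE => ->; rewrite orbT.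
have : cycle parent_rel (m :: q) by rewrite -def_s rot_cycle.
have : uniq (m :: q) by rewrite -def_s rot_uniq.
have : 2 < size (m :: q) by rewrite -def_s size_rot.
case: q sub {def_s} => [//|x q]; case/lastP: q => [//|q y] sub _.
move=> /and3P[mq xq _]; rewrite /= rcons_path last_rcons => /andP[mx /andP[_ ym]].
have neigh j : j \in x :: rcons q y -> parent_rel m j -> par m = j.
  move=> jq mj; apply: parent_of_larger mj _; rewrite ltn_neqAle mmax ?sub // andbT.
  by apply: contraNneq mq => /val_inj <-.
have yq : y \in rcons q y by rewrite mem_rcons mem_head.
have mpx := neigh x (mem_head _ _) mx.
rewrite parent_sym in ym; have mpy : par m = y by rewrite (neigh y) // inE yq orbT.
by move: xq; rewrite (val_inj (etrans (esym mpx) mpy)) yq.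
Qed.

Lemma parent_tree : is_tree parent_graph.
Proof.
split; last exact: parent_acyclic.
apply: (@parent_connected _ ord0); rewrite ?inE // => j _.
rewrite -lt0n => j0; split=> //.
have lt : par j < n.+1 by rewrite (ltn_trans (par_lt _)) ?ltn_ord ?j0.
by exists (Ordinal lt); rewrite ?inE.
Qed.

End Tree.

Lemma tree_like_treewidth s w :
  tree_like s ->
  (forall Y, Y \in s -> #|Y| <= w.+1) ->
  (forall v, exists2 Y, Y \in s & v \in Y) ->
  (forall u v, edge u v -> exists2 Y, Y \in s & (u \in Y) && (v \in Y)) ->
  treewidth G <= w.
Proof.
move=> /tree_like_parent[par s0 parP] sw sV sE.
rewrite /treewidth; case: ex_minnP => t _ tmin.
case: s s0 parP sw sV sE => // Y s; set n := size s => _ parP sw sV sE.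
have par_lt j : 0 < j < n.+1 -> par j < j by case/parP.
pose F := parent_graph par_lt; pose bag (x : F) := nth set0 (Y :: s) (x : 'I_n.+1).
apply: (@leq_trans (decomposition_width bag)); last first.
  rewrite /decomposition_width -subn1 leq_subLR add1n.
  by apply/bigmax_leqP => x _; apply: sw; rewrite mem_nth //= -/n.
apply: tmin; apply/asboolP; exists F, bag; split=> //; split.
- exact: parent_tree.
- move=> u v /sE[Z Zs /andP[uZ vZ]].
  have lt : index Z (Y :: s) < n.+1 by rewrite -/(size (Y :: s)) index_mem.
  by exists (Ordinal lt); rewrite /bag /= nth_index.
- move=> v.
  have [Z Zs vZ] := sV v.
  have lt : index Z (Y :: s) < n.+1 by rewrite -/(size (Y :: s)) index_mem.
  have i0 : v \in nth set0 (Y :: s) (Ordinal lt) by rewrite /= nth_index.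
  (* The first bag [r] containing [v] is the top of the subtree: any later bag [j] containing [v]
     shares [v] with bag [r], so the parent bag of [j] contains [v] too. *)
  case: (@arg_minnP _ (Ordinal lt) (fun i : 'I_n.+1 => v \in nth set0 (Y :: s) i) val i0).
  move=> r vr rmin; apply: (@parent_connected _ _ _ _ r); first by rewrite inE.
  move=> j; rewrite inE => vj jr; have := rmin j vj; rewrite leq_eqVlt eq_sym.
  rewrite (inj_eq val_inj) (negPf jr) /= => rj.
  have j0 : 0 < (j : 'I_n.+1) by apply: leq_ltn_trans rj.
  split=> //; have [|lt_par sub] := parP j; first by rewrite j0 ltn_ord.
  have ltn : par j < n.+1 by rewrite (ltn_trans lt_par).
  exists (Ordinal ltn) => //; rewrite inE; apply: (subsetP (sub _ rj)).
  by rewrite inE vr.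
Qed.

(** [U] is the part still to be decomposed, [S] contains all that it shares with the bags built so
    far, and [Z] is the bag to attach to. The recursion decreases [#|U| + #|U :\: S|]: either [S]
    grows by a vertex, or [U] is split. *)
Lemma tree_like_extend k : 0 < k ->
  (forall S, #|S| = 4 * k -> exists V1 V2, [/\ separation (@edge G) V1 V2,
     #|V1 :&: V2| < k, k <= #|S :&: V1| & k <= #|S :&: V2|]) ->
  forall U S s Z, S \subset U -> #|S| <= 4 * k ->
  tree_like s -> Z \in s -> S \subset Z -> (\bigcup_(X <- s) X) :&: U \subset S ->
  (forall X, X \in s -> #|X| <= (5 * k).-1) ->
  exists s', [/\ tree_like s', {subset s <= s'},
    \bigcup_(X <- s') X \subset (\bigcup_(X <- s) X) :|: U,
    (forall X, X \in s' -> #|X| <= (5 * k).-1)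
    & {in U &, forall u v, (u == v) || edge u v ->
        exists2 X, X \in s' & (u \in X) && (v \in X)}].
Proof.
move=> k0 bal U S; have [m] := ubnP (#|U| + #|U :\: S|).
elim: m U S => // m IH U S lem s Z SU S4 ts Zs SZ sUS sk.
have [US|] := eqVneq U S.
  exists s; split=> //; first exact: subsetUl.
  move=> u v uU vU _; exists Z => //.
  by rewrite !(subsetP SZ) -?US.
rewrite eqEsubset SU andbT => /subsetPn[v vU vS].
have leafP Y : Y \subset U -> S \subset Y -> #|Y| <= (5 * k).-1 ->
    [/\ tree_like (rcons s Y), Y \in rcons s Y,
      \bigcup_(X <- rcons s Y) X = (\bigcup_(X <- s) X) :|: Y &
      forall X, X \in rcons s Y -> #|X| <= (5 * k).-1].
  move=> YU SY Y5; split; last 1 first.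
  - by move=> X; rewrite mem_rcons inE => /predU1P[->|/sk].
  - apply: tree_like_leaf ts Zs (subset_trans (subset_trans _ sUS) SZ).
    exact: setIS.
  - by rewrite mem_rcons mem_head.
  - by rewrite -cats1 big_cat big_seq1.
have sub_rcons Y : {subset s <= rcons s Y}.
  by move=> X Xs; rewrite mem_rcons inE Xs orbT.
(* A small [S] is first enlarged by a vertex of [U], until the balanced separation becomes
   available. *)
have [S_lt|] := ltnP #|S| (4 * k).
  have vSU : v |: S \subset U by rewrite subUset sub1set vU.
  have vS4 : #|v |: S| <= 4 * k by rewrite cardsU1 vS.
  have [|ty Yy cy ky] := leafP (v |: S) vSU (subsetUr _ _); first lia.
  have [||s' [ts' ss' cs' ks' es']] := IH _ _ _ _ _ vSU vS4 ty Yy (subxx _) _ ky.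
  - rewrite -ltnS; apply: leq_trans lem; rewrite ltnS ltn_add2l.
    apply: proper_card; apply/properP; split; first by rewrite setDS ?subsetUr.
    by exists v; rewrite !inE ?vU ?vS // eqxx.
  - rewrite cy setIUl subUset (subset_trans sUS) ?subsetUr //; exact: subsetIl.
  exists s'; split=> // [X /sub_rcons/ss' //|].
  apply: subset_trans cs' _; rewrite cy -setUA setUS // subUset subxx andbT.
  exact: vSU.
move=> S_ge; have {S_ge S4} S4 : #|S| = 4 * k by apply/eqP; rewrite eqn_leq S4.
have [V1 [V2 [sep ltX k1 k2]]] := bal S S4.
set X := V1 :&: V2 in ltX.
have X_U : X :&: U \subset U by apply: subsetIr.
have SX_U : S :|: (X :&: U) \subset U by rewrite subUset SU.
have cardX : #|X :&: U| < k by apply: leq_ltn_trans ltX; apply/subset_leq_card/subsetIl.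
(* This bag has at most [4 * k + (k - 1)] vertices. *)
have [|ty Yy cy ky] := leafP (S :|: (X :&: U)) SX_U (subsetUl _ _).
  apply: leq_trans (leq_card_setU S (X :&: U)).1 _.
  by rewrite -ltnS prednK ?muln_gt0 ?k0 // S4 -addnS (mulSn 4) [leqRHS]addnC leq_add2l.
have half V V' : V :&: V' = X -> k <= #|S :&: V'| ->
    [/\ (S :|: (X :&: U)) :&: V \subset U :&: V,
        #|(S :|: (X :&: U)) :&: V| <= 4 * k &
        #|U :&: V| + #|(U :&: V) :\: ((S :|: (X :&: U)) :&: V)| < m].
  move=> VV' kV'.
  have XV : X \subset V by rewrite -VV' subsetIl.
  have cSV : #|S :\: V'| <= 3 * k.
    by rewrite cardsD S4 leq_subLR (mulSn 3) leq_add2r.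
  split; first exact: setSI.
    apply: (@leq_trans #|(S :\: V') :|: (X :&: U)|); last first.
      by rewrite (leq_trans (leq_card_setU _ _).1) // (mulSn 3) addnC leq_add // ltnW.
    apply/subset_leq_card/subsetP => w; rewrite -VV' !inE.
    case/andP=> /orP[wS|->]; last by rewrite orbT.
    by move=> wV; rewrite wS wV (subsetP SU) //; case: (w \in V').
  (* Since [S :&: V'] has more elements than [X], some vertex of [S] lies outside [V], so [U :&: V]
     is strictly smaller than [U]. *)
  have [w wS] : exists2 w, w \in S :&: V' & w \notin V.
    apply: contrapT => nw; have : #|S :&: V'| <= #|X|; last first.
      by rewrite leqNgt (leq_trans ltX).
    apply/subset_leq_card/subsetP => w wS; rewrite -VV' inE.
    have /setIP[_ ->] := wS; rewrite andbT; apply/negPn/negP => wV.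
    by apply: nw; exists w.
  have {wS} /setIP[wS _] := wS => wV; rewrite -ltnS; apply: leq_trans lem; rewrite ltnS.
  rewrite -addSn leq_add //.
    apply: proper_card; apply/properP; split; first exact: subsetIl.
    by exists w; rewrite ?(subsetP SU) // inE (negPf wV) andbF.
  apply/subset_leq_card/subsetP => u; rewrite !inE.
  case/andP=> nu /andP[uU uV]; rewrite uU andbT.
  by apply: contraNN nu => ->; rewrite uV.
have V12 u : (u \in V1) || (u \in V2) by rewrite -in_setU sep.1 inE.
have [sub1 card1 lt1] := half V1 V2 (erefl _) k2.
have [sub2 card2 lt2] := half V2 V1 (setIC _ _) k1.
have sS V : (S :|: (X :&: U)) :&: V \subset S :|: (X :&: U) by apply: subsetIl.
have [|s1 [ts1 ss1 cs1 ks1 es1]] := IH _ _ lt1 _ _ sub1 card1 ty Yy (sS V1) _ ky.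
  rewrite cy setIA setSI // setIUl subUset subsetIl andbT.
  exact: subset_trans sUS (subsetUl _ _).
(* The second half is attached to the same bag. The bags added for the first half lie in [U :&: V1],
   so they meet [U :&: V2] only inside [X :&: U], which that bag contains. *)
have [|s2 [ts2 ss2 cs2 ks2 es2]] :=
    IH _ _ lt2 _ _ sub2 card2 ts1 (ss1 _ Yy) (sS V2) _ ks1.
  apply: subset_trans (setSI _ cs1) _; rewrite cy -setUA setIUl subUset setIA.
  rewrite setSI ?(subset_trans sUS) ?subsetUl //=.
  apply/subsetP => u; rewrite !inE.
  by case: (u \in U); case: (u \in V1); case: (u \in V2); case: (u \in S).
exists s2; split=> // [Y /sub_rcons/ss1/ss2 //||u w uU wU uw].
- apply: subset_trans cs2 _; rewrite subUset; apply/andP; split; last first.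
    by rewrite subsetU // subsetIl orbT.
  apply: subset_trans cs1 _; rewrite cy !subUset subsetUl /=.
  by rewrite !(subset_trans _ (subsetUr _ U)) ?subsetIl.
- have [[uV1 wV1]|n1] := pselect (u \in V1 /\ w \in V1).
    have [||Y /ss2 Ys uwY] := es1 u w _ _ uw; rewrite ?inE ?uU ?wU //.
    by exists Y.
  have [[uV2 wV2]|n2] := pselect (u \in V2 /\ w \in V2).
    by apply: es2; rewrite ?inE ?uU ?wU.
  exfalso; case/orP: uw => [/eqP uw|uw].
    by have := V12 u; rewrite -uw in n1 n2 *; case/orP=> uV; [apply: n1 | apply: n2].
  have := V12 u; have := V12 w.
  have [uV1|uV1] := boolP (u \in V1); have [wV1|wV1] := boolP (w \in V1) => //=.
  + by case: n1.
  + move=> wV2 _; have uV2 : u \notin V2 by apply/negP => uV2; case: n2.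
    by have := sep.2 u w; rewrite uw !inE uV1 uV2 wV1 wV2 => /(_ isT isT).
  + move=> _ uV2; have wV2 : w \notin V2 by apply/negP => wV2; case: n2.
    by have := sep.2 w u; rewrite edge_sym uw !inE uV1 uV2 wV1 wV2 => /(_ isT isT).
  + by move=> wV2 uV2; case: n2.
Qed.

(** The recursion starts from a single empty bag with [S] empty; bags of size at most [5 * k - 1]
    have width at most [5 * k - 2]. *)
Lemma separations_treewidth k : 0 < k ->
  (forall S, #|S| = 4 * k -> exists V1 V2, [/\ separation (@edge G) V1 V2,
     #|V1 :&: V2| < k, k <= #|S :&: V1| & k <= #|S :&: V2|]) ->
  treewidth G <= (5 * k).-2.
Proof.
move=> k0 bal.
have [||||s [ts _ _ ks es]] := tree_like_extend (U := [set: G]) (S := set0)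
    k0 bal _ _ (tree_like1 set0) (mem_head _ _) (subxx _).
- exact: subsetT.
- by rewrite cards0.
- by rewrite big_seq1 set0I.
- by move=> X; rewrite inE => /eqP->; rewrite cards0.
- apply: tree_like_treewidth ts _ _ _ => [Y /ks|v|u v uv].
  + lia.
  + by have [|||Y Ys /andP[vY _]] := es v v; rewrite ?inE ?eqxx //; exists Y.
  + by apply: es; rewrite ?inE ?uv ?orbT.
Qed.

End BagSequences.

(** * Crossing chains in a disk *)

Import Order.TTheory GRing.Theory Num.Theory.
Local Open Scope ring_scope.

Lemma addb_cancel a b c : (a (+) b) (+) (b (+) c) = a (+) c.
Proof. by rewrite addbA -[X in X (+) _]addbA addbb addbF. Qed.

Section DiscreteCrossing.
Variable R : realFieldType.
Implicit Types u v w f : (R * R)%type.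

Definition dot u v := u.1 * v.1 + u.2 * v.2.
Definition cross u v := u.1 * v.2 - u.2 * v.1.
(** Twice the signed area of the triangle [u v w], positive when it is counterclockwise. *)
Definition orient u v w := cross (v - u) (w - u).

(* Whether the segment from [v] to [w] crosses the ray spanned by [u],
   provided that it avoids the origin. *)
Definition crosses u v w :=
  ((cross u v < 0) != (cross u w < 0)) && ((cross u v < 0) == (0 < cross v w)).

(** A ray that enters the open half-plane of [f] cuts it in two, and other rays miss it. So crossing
    is a sum modulo 2 of one term for each endpoint, and such sums telescope along paths and cancel
    around cells. *)
Lemma crosses_halfplane f u v w : 0 < dot f v -> 0 < dot f w ->
  crosses u v w =
  ((0 < dot f u) && (cross u v < 0)) (+) ((0 < dot f u) && (cross u w < 0)).
Proof.
move=> fv fw; rewrite /crosses.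
(* Cramer's rule paired with [f]: when [v] and [w] lie on different sides of the line of [u], it
   ties the sign of [cross v w] to that of [dot f u]. *)
have E : dot f u * cross v w = dot f v * cross u w - dot f w * cross u v.
  by rewrite /dot /cross; ring.
have [uv|uv] := ltP (cross u v) 0; have [uw|uw] := ltP (cross u w) 0;
  rewrite /= ?andbF ?addbb ?andbT ?addbF //.
- have : 0 < dot f u * cross v w by nra.
  have [fu|fu|<-] := ltgtP 0 (dot f u); last by rewrite mul0r ltxx.
    by rewrite pmulr_rgt0 // => ->.
  by rewrite nmulr_rgt0 // => /ltW/le_gtF ->.
- have : dot f u * cross v w < 0 by nra.
  have [fu|fu|<-] := ltgtP 0 (dot f u); last by rewrite mul0r ltxx.
    by rewrite pmulr_rlt0 // => /ltW/le_gtF ->.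
  by rewrite nmulr_rlt0 // => ->.
Qed.

Lemma crosses_path f u (v : nat -> R * R) n :
  (forall i, (i <= n)%N -> 0 < dot f (v i)) ->
  \big[addb/false]_(i < n) crosses u (v i) (v i.+1) = crosses u (v 0%N) (v n).
Proof.
elim: n => [|n IH] fv.
  by rewrite big_ord0 (crosses_halfplane _ (fv _ _) (fv _ _)) ?addbb.
rewrite big_ord_recr /= IH => [|i /leqW /fv //].
rewrite !(crosses_halfplane u (fv _ _) (fv _ _)) //.
exact: addb_cancel.
Qed.

Lemma crosses_square f u v00 v01 v10 v11 :
  0 < dot f v00 -> 0 < dot f v01 -> 0 < dot f v10 -> 0 < dot f v11 ->
  crosses u v00 v01 (+) crosses u v10 v11 = crosses u v00 v10 (+) crosses u v01 v11.
Proof.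
move=> f00 f01 f10 f11; rewrite !(@crosses_halfplane f) //.
by case: (_ && _); case: (_ && _); case: (_ && _); case: (_ && _).
Qed.

(** Every cell boundary crosses the ray an even number of times, and inner edges cancel modulo 2
    when the cells are summed. *)
Lemma crosses_grid u (v : nat -> nat -> R * R) m n :
  (forall i j, (i < m)%N -> (j < n)%N -> exists f,
     [/\ 0 < dot f (v i j), 0 < dot f (v i j.+1),
         0 < dot f (v i.+1 j) & 0 < dot f (v i.+1 j.+1)]) ->
  \big[addb/false]_(j < n) crosses u (v 0%N j) (v 0%N j.+1) (+)
  \big[addb/false]_(j < n) crosses u (v m j) (v m j.+1) =
  \big[addb/false]_(i < m) crosses u (v i 0%N) (v i.+1 0%N) (+)
  \big[addb/false]_(i < m) crosses u (v i n) (v i.+1 n).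
Proof.
move=> cell; have row i : (i < m)%N ->
    \big[addb/false]_(j < n) crosses u (v i j) (v i j.+1) (+)
    \big[addb/false]_(j < n) crosses u (v i.+1 j) (v i.+1 j.+1) =
    crosses u (v i 0%N) (v i.+1 0%N) (+) crosses u (v i n) (v i.+1 n).
  move=> im; have : forall j, (j < n)%N -> exists f,
     [/\ 0 < dot f (v i j), 0 < dot f (v i j.+1),
         0 < dot f (v i.+1 j) & 0 < dot f (v i.+1 j.+1)] by move=> j; apply: cell.
  elim: n {cell} => [|n IH] cell; first by rewrite !big_ord0 !addbb.
  have [f [f1 f2 f3 f4]] := cell n (ltnSn n).
  have := crosses_square u f1 f2 f3 f4.
  have := IH (fun j jn => cell j (leqW jn)); rewrite !big_ord_recr /=.
  by move=> IHn sq; rewrite addbACA IHn sq addb_cancel.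
elim: m {cell} row => [|m IH] row; first by rewrite !big_ord0 !addbb.
have := row m (ltnSn m); have := IH (fun i im => row i (leqW im)).
rewrite !big_ord_recr /=.
by move=> IHm rowm; rewrite addbACA -IHm -rowm addb_cancel.
Qed.

(** Twice [dot a (a - q)] is the sum of [dot a a - dot q q] and the squared distance of [a] and [q];
    the disk lies on one side of its tangent at [a]. *)
Lemma circle_halfplane r a q : dot a a = r -> dot q q <= r -> a != q ->
  0 < dot a (a - q).
Proof.
move=> ar qr; rewrite /eq_op /= negb_and => aq.
have : 0 < (a.1 - q.1) ^+ 2 + (a.2 - q.2) ^+ 2.
  case/orP: aq => aq; [apply: ltr_pwDl | apply: ltr_pwDr];
    by rewrite ?sqr_ge0 // exprn_even_gt0 //= subr_eq0.
move: ar qr; rewrite /dot /=; nra.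
Qed.

Lemma discrete_crossing r m n (p q : nat -> R * R) :
  (forall i, (i <= m)%N -> dot (p i) (p i) <= r) ->
  (forall j, (j <= n)%N -> dot (q j) (q j) <= r) ->
  dot (p 0%N) (p 0%N) = r -> dot (p m) (p m) = r ->
  dot (q 0%N) (q 0%N) = r -> dot (q n) (q n) = r ->
  (forall i j, (i <= m)%N -> (j <= n)%N -> p i != q j) ->
  (forall i j, (i < m)%N -> (j < n)%N -> exists f,
     [/\ 0 < dot f (p i - q j), 0 < dot f (p i - q j.+1),
         0 < dot f (p i.+1 - q j) & 0 < dot f (p i.+1 - q j.+1)]) ->
  0 < orient (p 0%N) (q 0%N) (p m) -> 0 < orient (p 0%N) (q 0%N) (q n) ->
  0 < orient (q 0%N) (p m) (q n) -> 0 < orient (p 0%N) (p m) (q n) -> False.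
Proof.
move=> pD qD pa pb qc qd pq cell acb acd cbd abd.
have := crosses_grid (p m - p 0%N) (v := fun i j => p i - q j) cell.
have neg x y : dot x x = r -> dot y y <= r -> y != x -> 0 < dot (- x) (y - x).
  move=> xr yr yx; have := circle_halfplane xr yr; rewrite eq_sym => /(_ yx).
  by rewrite /dot /=; lra.
(* Along each side of the grid one of the two points stays fixed on the circle, so the side lies in
   one half-plane and only its corners count. *)
rewrite (@crosses_path (p 0%N) _ (fun j => p 0%N - q j)); last first.
  by move=> j jn; apply: circle_halfplane pa (qD _ jn) (pq _ _ _ jn).
rewrite (@crosses_path (p m) _ (fun j => p m - q j)); last first.
  by move=> j jn; apply: circle_halfplane pb (qD _ jn) (pq _ _ _ jn).
rewrite (@crosses_path (- q 0%N) _ (fun i => p i - q 0%N)); last first.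
  by move=> i im; apply: neg qc (pD _ im) (pq _ _ im _).
rewrite (@crosses_path (- q n) _ (fun i => p i - q n)); last first.
  by move=> i im; apply: neg qd (pD _ im) (pq _ _ im _).
(* Of the four sides only the one from [b - c] to [b - d] crosses the ray spanned by [b - a], an odd
   total. *)
move: acb acd cbd abd; rewrite /orient /crosses /cross /=.
set a := p 0%N; set b := p m; set c := q 0%N; set d := q n => acb acd cbd abd.
have -> : ((b.1 - a.1) * (a.2 - c.2) - (b.2 - a.2) * (a.1 - c.1) < 0) = false by lra.
have -> : ((b.1 - a.1) * (b.2 - c.2) - (b.2 - a.2) * (b.1 - c.1) < 0) = false by lra.
have -> : ((b.1 - a.1) * (a.2 - d.2) - (b.2 - a.2) * (a.1 - d.1) < 0) = true by lra.
have -> : ((b.1 - a.1) * (b.2 - d.2) - (b.2 - a.2) * (b.1 - d.1) < 0) = true by lra.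
have -> : (0 < (a.1 - c.1) * (a.2 - d.2) - (a.2 - c.2) * (a.1 - d.1)) = true by lra.
have -> : (0 < (b.1 - c.1) * (b.2 - d.2) - (b.2 - c.2) * (b.1 - d.1)) = false by lra.
by [].
Qed.

End DiscreteCrossing.

(** * Points of a circle and their half-angles *)

Section CyclicOrder.
Variable R : rcfType.
Implicit Types z : (R * R)%type.

(* [z = r e^(i t)] and [h = e^(i t / 2)] with [0 <= t < 2 pi], so that the
   counterclockwise order of the [z] is the decreasing order of the [h.1]. *)
Definition half_angle (r : R) z (h : R * R) :=
  [/\ h.1 ^+ 2 + h.2 ^+ 2 = 1, 0 <= h.2, h.2 = 0 -> h.1 = 1,
      z.1 = r * (h.1 ^+ 2 - h.2 ^+ 2) & z.2 = r * (2 * h.1 * h.2)].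

Lemma half_angle_exists (r : R) z :
  0 < r -> dot z z = r ^+ 2 -> exists h, half_angle r z h.
Proof.
move=> r0 zr; pose x := z.1 / r; pose y := z.2 / r.
have zx : z.1 = r * x by rewrite /x mulrC divfK ?gt_eqF.
have zy : z.2 = r * y by rewrite /y mulrC divfK ?gt_eqF.
have xy : x ^+ 2 + y ^+ 2 = 1.
  have r2 : r ^+ 2 != 0 by rewrite expf_eq0 gt_eqF.
  by apply: (mulfI r2); rewrite mulr1 -[RHS]zr /dot zx zy; ring.
have x1 : (1 - x) / 2 >= 0 by nra.
have x2 : (1 + x) / 2 >= 0 by nra.
pose s := Num.sqrt ((1 - x) / 2).
have s0 : 0 <= s by apply: sqrtr_ge0.
have ss : s ^+ 2 = (1 - x) / 2 by rewrite sqr_sqrtr.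
pose c0 := Num.sqrt ((1 + x) / 2).
have c00 : 0 <= c0 by apply: sqrtr_ge0.
have cc : c0 ^+ 2 = (1 + x) / 2 by rewrite sqr_sqrtr.
have y2 : y ^+ 2 = (2 * c0 * s) ^+ 2.
  have -> : y ^+ 2 = 1 - x ^+ 2 by lra.
  have -> : (2 * c0 * s) ^+ 2 = 4 * c0 ^+ 2 * s ^+ 2 by ring.
  by rewrite cc ss; field.
have cs0 : 0 <= 2 * c0 * s by nra.
(* The half-angle formulas give the sine and the absolute value of the cosine; the cosine takes the
   sign of [y]. *)
clearbody c0 s; have [y0|y0] := leP 0 y.
  exists (c0, s); split; rewrite //=.
  - lra.
  - move=> sE; rewrite sE expr0n /= in ss; apply/eqP.
    by rewrite -(eqrXn2 (n := 2)) ?ler01 // expr1n; apply/eqP; lra.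
  - by rewrite zx cc ss; lra.
  - by rewrite zy; congr (_ * _); apply/eqP; rewrite -(eqrXn2 (n := 2)) // y2.
exists (- c0, s); split; rewrite //=.
- lra.
- by move=> sE; move: y2; rewrite sE mulr0 expr0n /=; nra.
- by rewrite zx sqrrN cc ss; lra.
- rewrite zy; congr (_ * _); apply/eqP; rewrite mulrN mulNr -eqr_oppLR.
  by rewrite -(eqrXn2 (n := 2)) ?sqrrN ?y2 // oppr_ge0 ltW.
Qed.

Lemma half_angle_inj r z z' h h' : half_angle r z h -> half_angle r z' h' ->
  h.1 = h'.1 -> z = z'.
Proof.
case: z h z' h' => [x y] [c s] [x' y'] [c' s'] [/= N s0 _ -> ->] [/= N' s0' _ -> ->] cc'.
have <- : s = s' by apply/eqP; rewrite -(eqrXn2 (n := 2)) //; apply/eqP; nra.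
by rewrite cc'.
Qed.

(** Each [cross] is the sine of half the difference of two angles, so this is the area of an
    inscribed triangle as a product of its chords. *)
Lemma orient_half_angle r z1 z2 z3 h1 h2 h3 :
  half_angle r z1 h1 -> half_angle r z2 h2 -> half_angle r z3 h3 ->
  orient z1 z2 z3 = 4 * r ^+ 2 * (cross h1 h2 * cross h2 h3 * cross h1 h3).
Proof.
case: z1 h1 z2 h2 z3 h3 => [x1 y1] [c1 s1] [x2 y2] [c2 s2] [x3 y3] [c3 s3].
move=> [/= N1 _ _ -> ->] [/= N2 _ _ -> ->] [/= N3 _ _ -> ->].
rewrite /orient /cross /=.
(* The factors [c ^+ 2 + s ^+ 2], all equal to 1, make the sum homogeneous, so that its
   factorization is a polynomial identity. *)
transitivity (2 * r ^+ 2 * (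
    (c1 * s2 - s1 * c2) * (c1 * c2 + s1 * s2) * (c3 ^+ 2 + s3 ^+ 2) +
    (c2 * s3 - s2 * c3) * (c2 * c3 + s2 * s3) * (c1 ^+ 2 + s1 ^+ 2) -
    (c1 * s3 - s1 * c3) * (c1 * c3 + s1 * s3) * (c2 ^+ 2 + s2 ^+ 2))); last by ring.
rewrite N1 N2 N3.
transitivity (2 * r ^+ 2 * (
    (c1 * s2 - s1 * c2) * (c1 * c2 + s1 * s2) +
    (c2 * s3 - s2 * c3) * (c2 * c3 + s2 * s3) -
    (c1 * s3 - s1 * c3) * (c1 * c3 + s1 * s3))); last by ring.
ring.
Qed.

(** The half-angles lie between 0 and pi, where cosine decreases; the cross product is the sine of
    their difference. *)
Lemma cross_half_angle r z1 z2 h1 h2 :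
  half_angle r z1 h1 -> half_angle r z2 h2 -> h2.1 < h1.1 -> 0 < cross h1 h2.
Proof.
case: h1 h2 => [c1 s1] [c2 s2] [/= N1 s10 e1 _ _] [/= N2 s20 e2 _ _] lt.
have s2_gt0 : 0 < s2.
  rewrite lt_neqAle s20 andbT eq_sym; apply/eqP => /e2 c2E.
  by rewrite c2E in lt; nra.
rewrite /cross /=; have [c1_gt0|c1_le0] := ltP 0 c1.
  have [c2_gt0|c2_le0] := ltP 0 c2; last by nra.
  have : s1 < s2 by rewrite ltNge; apply/negP => le; nra.
  nra.
have : s2 < s1 by rewrite ltNge; apply/negP => le; nra.
nra.
Qed.

Lemma orient_gt0 r z1 z2 z3 h1 h2 h3 : 0 < r ->
  half_angle r z1 h1 -> half_angle r z2 h2 -> half_angle r z3 h3 ->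
  h2.1 < h1.1 -> h3.1 < h2.1 -> 0 < orient z1 z2 z3.
Proof.
move=> r0 H1 H2 H3 h21 h32; rewrite (orient_half_angle H1 H2 H3).
have h31 := lt_trans h32 h21.
by rewrite !mulr_gt0 ?exprn_gt0 ?(cross_half_angle H1 H2) ?(cross_half_angle H2 H3)
  ?(cross_half_angle H1 H3).
Qed.

End CyclicOrder.

(* The set notations of MathComp-Analysis shadow those of finset. *)
From mathcomp Require Import all_classical all_reals all_analysis.
Import numFieldNormedType.Exports.

(** * Chains of small steps in plane sets *)

Section Chains.
Variable R : realType.
Local Open Scope classical_set_scope.
Implicit Types (K L : set (R * R)) (x y z : R * R).

Lemma ball_coord x e y :
  ball x e y <-> `|x.1 - y.1| < e /\ `|x.2 - y.2| < e.
Proof. by []. Qed.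

Inductive chain K e x : R * R -> Prop :=
| chain0 : K x -> chain K e x x
| chainS y z : chain K e x y -> K z -> ball y e z -> chain K e x z.

Lemma chain_mem K e x y : chain K e x y -> K y.
Proof. by case=> [|? ? _ ? _]. Qed.

Lemma chain_sub K L e x y : K `<=` L -> chain K e x y -> chain L e x y.
Proof.
move=> KL; elim=> [/KL|u v _ xu /KL Lv uv]; first exact: chain0.
exact: chainS xu Lv uv.
Qed.

Lemma chain_trans K e x y z : chain K e x y -> chain K e y z -> chain K e x z.
Proof. by move=> xy; elim=> // u v _ xu Kv uv; apply: chainS xu Kv uv. Qed.

(** The points reachable from [x] form a set that is both open and closed in [K]. *)
Lemma chain_connected K e x y :
  0 < e -> connected K -> K x -> K y -> chain K e x y.
Proof.
move=> e0 cK Kx Ky; pose B := [set z | chain K e x z].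
suff BK : B = K by have : B y by rewrite BK.
apply: cK.
- by exists x; apply: chain0.
- exists (\bigcup_(z in B) ball z e).
    by apply: bigcup_open => z _; apply: ball_open.
  apply/seteqP; split=> [z Bz|z [Kz [w Bw wz]]].
    by split; [exact: chain_mem Bz | exists z => //; apply: ballxx].
  exact: chainS Bw Kz wz.
- exists (~` \bigcup_(z in K `\` B) ball z e).
    by apply: open_closedC; apply: bigcup_open => z _; apply: ball_open.
  apply/seteqP; split=> [z Bz|z [Kz nz]].
    split; first exact: chain_mem Bz.
    by case=> w [Kw nBw] wz; apply: nBw; apply: chainS Bz Kw (ball_sym wz).
  by apply: contrapT => nBz; apply: nz; exists z => //; apply: ballxx.
Qed.

Lemma chain_sequence K e x y : chain K e x y ->
  exists n (p : nat -> R * R), [/\ p 0%N = x, p n = y,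
    forall i, (i <= n)%N -> K (p i) &
    forall i, (i < n)%N -> ball (p i) e (p i.+1)].
Proof.
elim=> [Kx|{}y z _ [n [p [p0 pn pK pe]]] Kz yz].
  by exists 0%N, (fun=> x); split.
exists n.+1, (fun i => if (i <= n)%N then p i else z).
split=> [||i|i]; rewrite ?ltnn ?p0 //.
  rewrite leq_eqVlt => /predU1P[->|]; rewrite ?ltnn //.
  by rewrite ltnS => le; rewrite le; apply: pK.
rewrite ltnS => le; rewrite le; case: (ltnP i n) => [|ge]; first exact: pe.
by rewrite (_ : i = n) ?pn //; apply/eqP; rewrite eqn_leq le.
Qed.

(** Each point of [K] has a ball of some radius [e] missing [L], so radius [e / 2] works for all
    nearby points; compactness makes the radius uniform. *)
Lemma compact_closed_far K L : compact K -> closed L -> K `&` L = set0 ->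
  \forall d \near 0^'+, forall x y, K x -> L y -> ~ ball x d y.
Proof.
move=> /compact_near_coveringP cK cL KL.
suff : \forall d \near 0^'+, K `<=` [set x | forall y, L y -> ~ ball x d y].
  by apply: filterS => d sub x y /sub; apply.
apply: cK => x Kx.
have : nbhs x (~` L).
  apply: open_nbhs_nbhs; split; first exact: closed_openC.
  by move=> Lx; rewrite -[False]/(set0 x) -KL.
move=> /nbhs_ballP[e /= e0 eL].
near=> x' d => /= y Ly x'y.
apply: (eL y) => //; apply: (@ball_split _ _ x'); last first.
  apply: le_ball x'y; near: d; apply: nbhs_right_le; exact: divr_gt0.
near: x'; apply: nbhsx_ballx; exact: divr_gt0.
Unshelve. all: by end_near.
Qed.

(** Balls are those of the maximum norm, so [p] and [q] differ by at least [d] in some coordinate.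
    Moving each by less than [d / 4] keeps the sign of that difference, and [f] is this coordinate
    up to sign. *)
Lemma far_halfplane (d : R) (p p' q q' : R * R) : 0 < d ->
  ball p (d / 4) p' -> ball q (d / 4) q' -> ~ ball p d q ->
  exists f, [/\ 0 < dot f (p - q), 0 < dot f (p - q'),
    0 < dot f (p' - q) & 0 < dot f (p' - q')].
Proof.
case: p p' q q' => [px py] [px' py'] [qx qy] [qx' qy'] d0.
move=> /ball_coord[/= + +] /ball_coord[/= + +] /(contra_not (ball_coord _ _ _).2).
rewrite !(ltr_norml _ (d / 4)) => /andP[? ?] /andP[? ?] /andP[? ?] /andP[? ?].
move=> /not_andP[] /negP; rewrite -leNgt ler_normr /= => /orP[far_pq|far_pq].
- by exists (1, 0); rewrite /dot /=; split; lra.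
- by exists (-1, 0); rewrite /dot /=; split; lra.
- by exists (0, 1); rewrite /dot /=; split; lra.
- by exists (0, -1); rewrite /dot /=; split; lra.
Qed.

Lemma chains_crossing a0 r K L d z1 z2 z3 z4 h1 h2 h3 h4 :
  0 < r -> 0 < d ->
  (forall x y, K x -> L y -> ~ ball x d y) ->
  K `<=` closed_disk a0 r -> L `<=` closed_disk a0 r ->
  chain K (d / 4) z1 z3 -> chain L (d / 4) z2 z4 ->
  half_angle r (z1 - a0) h1 -> half_angle r (z2 - a0) h2 ->
  half_angle r (z3 - a0) h3 -> half_angle r (z4 - a0) h4 ->
  h2.1 < h1.1 -> h3.1 < h2.1 -> h4.1 < h3.1 -> False.
Proof.
move=> r0 d0 far KD LD.
move=> /chain_sequence[m [p [p0 pm pK pe]]] /chain_sequence[n [q [q0 qn qL qe]]].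
move=> H1 H2 H3 H4 h21 h32 h43.
have disk x : closed_disk a0 r x -> dot (x - a0) (x - a0) <= r ^+ 2.
  by rewrite /closed_disk /= /sqdist /dot /= -!expr2.
have circle z h : half_angle r z h -> dot z z = r ^+ 2.
  case=> N _ _ z1E z2E; rewrite /dot z1E z2E.
  transitivity (r ^+ 2 * (h.1 ^+ 2 + h.2 ^+ 2) ^+ 2); first ring.
  by rewrite N expr1n mulr1.
pose p' i := p i - a0; pose q' j := q j - a0.
have pq i j : p' i - q' j = p i - q j by rewrite /p' /q' opprB addrA subrK.
apply: (@discrete_crossing R (r ^+ 2) m n p' q').
- by move=> i /pK/KD/disk.
- by move=> j /qL/LD/disk.
- by rewrite /p' p0; apply: circle H1.
- by rewrite /p' pm; apply: circle H3.
- by rewrite /q' q0; apply: circle H2.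
- by rewrite /q' qn; apply: circle H4.
- move=> i j im jn; rewrite -subr_eq0 pq subr_eq0; apply/eqP => pqE.
  by apply: (far (p i) (q j)); [exact: pK | exact: qL | rewrite pqE; apply: ballxx].
- move=> i j im jn; rewrite !pq.
  apply: far_halfplane d0 (pe i im) (qe j jn) _.
  by apply: far; [exact: pK (ltnW im) | exact: qL (ltnW jn)].
- by rewrite /p' /q' p0 q0 pm; apply: orient_gt0 H1 H2 H3 _ _.
- by rewrite /p' /q' p0 q0 qn; apply: orient_gt0 H1 H2 H4 _ (lt_trans h43 h32).
- by rewrite /p' /q' pm q0 qn; apply: orient_gt0 H2 H3 H4 _ _.
- by rewrite /p' /q' p0 pm qn; apply: orient_gt0 H1 H3 H4 (lt_trans h32 h21) _.
Qed.

Lemma trace_connected (c : R -> R * R) : curve c -> connected (trace c).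
Proof.
move=> cc; apply: connected_continuous_connected cc.
exact/connected_intervalP/interval_is_interval.
Qed.

Lemma trace_compact (c : R -> R * R) : curve c -> compact (trace c).
Proof. by move=> cc; apply: continuous_compact cc (@segment_compact _ _ _). Qed.

End Chains.

(** * The vertex order of an outer-string graph *)

Section OuterStringOrder.
Variables (R : realType) (G : sgraph).
Local Open Scope classical_set_scope.

Definition union_traces (c : G -> R -> R * R) (P : {set G}) : set (R * R) :=
  [set z | exists2 u, u \in P & trace (c u) z].

(** The chain follows a path of [G] inside [P], passing from each curve to the next at a common
    point. *)
Lemma union_traces_chain (c : G -> R -> R * R) (P : {set G}) e u v x y :
  0 < e -> (forall v, curve (c v)) -> is_intersection_graph (fun v => trace (c v)) ->
  conn (@edge G) P -> u \in P -> v \in P -> trace (c u) x -> trace (c v) y ->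
  chain (union_traces c P) e x y.
Proof.
move=> e0 cc cG [_ cP] uP vP; have /connectP[p] := cP u v uP vP.
have in_trace w z z' : w \in P -> trace (c w) z -> trace (c w) z' ->
    chain (union_traces c P) e z z'.
  move=> wP wz wz'; have := chain_connected e0 (trace_connected (cc w)) wz wz'.
  by apply: chain_sub => t wt; exists w.
elim: p u x uP => /= [u x uP _ ->|w p IH u x uP]; first exact: in_trace.
move=> /andP[/and3P[_ wP uw] pP] vE ux vy.
have [|z [uz wz]] := (cG u w _).1 uw.
  by apply: contraTneq uw => ->; rewrite edge_irrefl.
exact: chain_trans (in_trace u x z uP ux uz) (IH w z wP pP vE wz vy).
Qed.

Lemma outer_string_crossing_order : outer_string R G ->
  exists idx : G -> nat, injective idx /\ crossing_order idx.
Proof.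
case=> a0 [r [c [r0 outer cG]]].
have cc v : curve (c v) by case: (outer v).
have /choice[root rootP] v : exists z, trace (c v) z /\ boundary_circle a0 r z.
  have [_ _ [c0|c1]] := outer v; [exists (c v 0) | exists (c v 1)]; split=> //.
    by exists 0 => //=; rewrite in_itv /= lexx ler01.
  by exists 1 => //=; rewrite in_itv /= lexx ler01.
have /choice[h hP] v : exists h, half_angle r (root v - a0) h.
  by apply: half_angle_exists r0 _; have [_ <-] := rootP v; rewrite /dot -!expr2.
(* Decreasing [h.1] is counterclockwise order. Curves with the same root are ordered arbitrarily, so
   [idx] yields only weak inequalities between keys. *)
pose le_key : rel G := [rel u v | (h v).1 <= (h u).1].
have le_key_trans : transitive le_key by move=> u v w /= vu uw; apply: le_trans uw vu.
have le_key_total : total le_key by move=> u v; apply: le_total.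
pose s := sort le_key (enum G); pose idx v := index v s.
have ins v : v \in s by rewrite mem_sort mem_enum.
have idx_key u v : (idx u < idx v)%N -> (h v).1 <= (h u).1.
  by apply: (sorted_ltn_index le_key_trans (sort_sorted le_key_total _)).
exists idx; split=> [u v|P Q a b c' d cP cQ aP bP cQ' dQ ac cb bd].
  by move/(congr1 (nth u s)); rewrite !nth_index.
apply: contrapT => ntouch.
have disj u v : u \in P -> v \in Q -> trace (c u) `&` trace (c v) = set0.
  move=> uP vQ; apply/seteqP; split=> // z [uz vz]; apply: ntouch.
  exists u, v; split=> //; have [//|uv] := eqVneq u v.
  by apply/(cG u v uv); exists z.
(* Equal keys would mean a common root, but the traces from [P] and [Q] are disjoint. *)
have key_lt u v : u \in P -> v \in Q -> (h u).1 != (h v).1.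
  move=> uP vQ; apply/eqP => /(half_angle_inj (hP u) (hP v)) /addIr uv.
  have [uz _] := rootP u; have [vz _] := rootP v.
  by rewrite -[False]/(set0 (root u)) -(disj u v uP vQ); split; rewrite ?uv // -uv.
(* There are finitely many pairs of curves, so one distance serves them all. *)
have : \forall e \near 0^'+, forall uv : G * G, uv.1 \in P -> uv.2 \in Q ->
    forall x y, trace (c uv.1) x -> trace (c uv.2) y -> ~ ball x e y.
  apply: filter_forall => -[u v] /=.
  have [uP|nP] := boolP (u \in P); last by apply: nearW.
  have [vQ|nQ] := boolP (v \in Q); last by apply: nearW.
  have clv : closed (trace (c v)).
    by apply: compact_closed (trace_compact (cc v)); apply: norm_hausdorff.
  apply: filterS (compact_closed_far (trace_compact (cc u)) clv (disj u v uP vQ)).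
  by move=> e far _ _; apply: far.
move=> /(filterI (nbhs_right_gt 0))/filter_ex[e [e0 far]].
have e40 : 0 < e / 4 by apply: divr_gt0.
have in_disk (W : {set G}) : union_traces c W `<=` closed_disk a0 r.
  by move=> z [u _ uz]; have [_ sub _] := outer u; apply: sub.
have chPQ (W : {set G}) u v : conn (@edge G) W -> u \in W -> v \in W ->
    chain (union_traces c W) (e / 4) (root u) (root v).
  by move=> cW uW vW; apply: (union_traces_chain e40 cc cG cW uW vW);
    [case: (rootP u) | case: (rootP v)].
apply: (chains_crossing r0 e0 _ (@in_disk P) (@in_disk Q)
  (chPQ P a b cP aP bP) (chPQ Q c' d cQ cQ' dQ) (hP a) (hP c') (hP b) (hP d)).
- by move=> x y [u uP ux] [v vQ vy]; apply: (far (u, v)).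
- by rewrite lt_neqAle idx_key // eq_sym key_lt.
- by rewrite lt_neqAle idx_key // key_lt.
- by rewrite lt_neqAle idx_key // eq_sym key_lt.
Qed.

End OuterStringOrder.

Theorem theorem4 (R : realType) (G : sgraph) (hG : (0 < #|G|)%N)
    (hos : outer_string R G) :
  (treewidth G)%:Z <= 15 * (hadwiger G)%:Z - 2.
Proof.
(* A single vertex is a complete minor of order 1; positivity is needed for the recursion with
   [k = 3 * hadwiger G]. *)
have h0 : (0 < hadwiger G)%N.
  have /card_gt0P[v _] := hG.
  have := complete_minorP (F := fun _ : 'I_1 => finset.set1 v) (I := finset.setTfor 'I_1).
  rewrite cardsT card_ord; apply=> [i _|i j _ _]; first exact: conn1.
  by rewrite (ord1 i) (ord1 j) eqxx.
have [idx [idx_inj crossing]] := outer_string_crossing_order hos.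
have tw := separations_treewidth _ (balanced_separation idx_inj crossing h0 (leqnn _)).
have {}tw : (treewidth G <= (5 * (3 * hadwiger G)).-2)%N by apply: tw; rewrite muln_gt0.
lia.
Qed.
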